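(* Let $X=X_1\times X_2$ be a product of two proper Hadamard spaces with the standard product metric and let $G\subset Is(X_1)\times Is(X_2)$ be a group acting properly on $X$. Assume that $G$ contains two elements $g=(g_1,g_2)$ and $h=(h_1,h_2)$ such that, for each $i\in\{1,2\}$, $g_i$ and $h_i$ are independent rank one isometries of $X_i$, and that the action satisfies the regular growth condition, i.e. $\delta_\theta\ge 0$ for every $\theta\in[0,\pi/2]$. Then the growth rate $\delta_\theta$ of $G$ with slope $\theta$ is positive for every $\theta\in(0,\pi/2)$.
   Context: A Hadamard space is a complete simply connected metric space of non-positive Alexandrov curvature (a complete CAT(0) space); it is proper if all balls of finite radius are compact. For $(X_1,d_1),(X_2,d_2)$ proper Hadamard spaces, $X=X_1\times X_2$ carries the metric $d=\sqrt{d_1^2+d_2^2}$; $Is(X_i)$ is the isometry group of $X_i$; $o=(o_1,o_2)\in X$ is a fixed base point. A group $G\subset Is(X_1)\times Is(X_2)$ acts properly on $X$ if $\{g\in G: d(x,gx)\le r\}$ is finite for all $x\in X$, $r>0$. An isometry of a Hadamard space is rank one if it acts as a translation on a geodesic axis which does not bound a flat half plane; it then fixes the two endpoints of its axis in the geometric boundary. Two rank one isometries are independent if their sets of fixed boundary endpoints are disjoint. For $g=(g_1,g_2)\in G$ with $go\ne o$ let $\theta(g)=\arctan\frac{d_2(o_2,g_2o_2)}{d_1(o_1,g_1o_1)}\in[0,\pi/2]$ (with value $\pi/2$ if the denominator is $0$). For $\theta\in[0,\pi/2]$, $\epsilon>0$, integer $n\ge1$, put $A_{\epsilon,\theta}(o,n)=\{g\in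 G: go\neq o,\ n-1\le d(o,go)<n,\ |\theta(g)-\theta|\le\epsilon\}$, $\delta_{\epsilon,\theta}=\limsup_{n\to\infty}\frac{\log|A_{\epsilon,\theta}(o,n)|}{n}$ (with $\log 0=-\infty$), and $\delta_\theta=\liminf_{\epsilon\to0}\delta_{\epsilon,\theta}\in[-\infty,\infty)$. The number $\delta_\theta$ is the growth rate of $G$ with slope $\theta$. *)

(* Defs.v *)
From HB Require Import structures.
From mathcomp Require Import all_boot all_order all_algebra.
From mathcomp Require Import all_classical all_reals all_analysis.

Set Implicit Arguments.
Unset Strict Implicit.
Unset Printing Implicit Defensive.
Import Order.TTheory GRing.Theory Num.Theory.
Import numFieldNormedType.Exports.

Local Open Scope classical_set_scope.
Local Open Scope ring_scope.

#[short(type="completeMetricType")]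
HB.structure Definition CompleteMetric (R : numDomainType) :=
  {X of Complete X & Metric R X}.

(* The type [X1 * X2] also carries the max-pseudometric of the library; the
   standard product metric of two metric spaces is the following one.  With
   [X1 = X2 = R^o] it is the Euclidean metric of the plane. *)
Definition prod_dist (R : realType) (X1 X2 : metricType R) (x y : X1 * X2) : R :=
  Num.sqrt (mdist x.1 y.1 ^+ 2 + mdist x.2 y.2 ^+ 2).

Definition plane_dist (R : realType) : R^o * R^o -> R^o * R^o -> R :=
  @prod_dist R R^o R^o.

Section Geodesics.
Context {R : realType} {T : Type} (d : T -> T -> R).

(* Only the values of [c] on the interval [0, d p q] are relevant. *)
Definition geodesic (p q : T) (c : R -> T) :=
  [/\ c 0 = p, c (d p q) = q &
    {in `[0, d p q] &, forall s t, d (c s) (c t) = `|s - t|}].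

(* Only the values of [c] on the half-line [0, +oo[ are relevant. *)
Definition geodesic_ray (c : R -> T) :=
  {in `[0, +oo[ &, forall s t, d (c s) (c t) = `|s - t|}.

Definition geodesic_line (c : R -> T) := forall s t, d (c s) (c t) = `|s - t|.

Definition geodesic_space := forall p q, exists c, geodesic p q c.

End Geodesics.

Section Hadamard.
Context {R : realType}.

(* Every geodesic triangle is at least as thin as its comparison triangle
   [p' q' r'] in the Euclidean plane: a point on a side issued from [p] and a
   point on another side issued from [p] are compared with the points at the
   same distances from [p'] on the corresponding sides.  As [p], [q], [r] are
   arbitrary, this covers all pairs of points on two sides of a triangle; on a
   single side the comparison is an equality. *)
Definition cat0 (X : metricType R) :=
  geodesic_space (@mdist R X) /\
  forall (p q r : X) (p' q' r' : R^o * R^o)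
      (c1 c2 : R -> X) (e1 e2 : R -> R^o * R^o),
    plane_dist p' q' = mdist p q ->
    plane_dist p' r' = mdist p r ->
    plane_dist q' r' = mdist q r ->
    geodesic mdist p q c1 -> geodesic mdist p r c2 ->
    geodesic (@plane_dist R) p' q' e1 -> geodesic (@plane_dist R) p' r' e2 ->
    {in `[0, mdist p q] & `[0, mdist p r], forall s t,
      mdist (c1 s) (c2 t) <= plane_dist (e1 s) (e2 t)}.

Definition proper_space (X : metricType R) :=
  forall (x : X) (r : R), compact [set y | mdist x y <= r].

(* Completeness is part of the type. *)
Definition proper_hadamard (X : completeMetricType R) :=
  cat0 X /\ proper_space X.

End Hadamard.

Section IsometryGroup.
Context {R : realType} (X : metricType R).
Local Open Scope group_scope.

Definition isometry (f : X -> X) :=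
  (forall x y, mdist (f x) (f y) = mdist x y) /\ bijective f.

Record isom := Isom { isom_fun :> X -> X; isom_prop : `[< isometry isom_fun >] }.

HB.instance Definition _ := [isSub for isom_fun].
HB.instance Definition _ := [Choice of isom by <:].

Lemma isomP (f : isom) : isometry f.
Proof. exact/asboolP/isom_prop. Qed.

Lemma isom_eq (f g : isom) : f =1 g -> f = g.
Proof. by move=> fg; apply/val_inj/funext. Qed.

Fact isom_one_subproof : `[< isometry idfun >].
Proof. by apply/asboolP; split=> //; exists idfun. Qed.
Definition isom_one := Isom isom_one_subproof.

Fact isom_mul_subproof (f g : isom) : `[< isometry (f \o g) >].
Proof.
apply/asboolP; have [[df bf] [dg bg]] := (isomP f, isomP g).
by split=> [x y /=|]; [rewrite df dg | exact: bij_comp].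
Qed.
Definition isom_mul (f g : isom) := Isom (isom_mul_subproof f g).

Fact isom_inv_exists (f : isom) : exists g : X -> X, cancel f g /\ cancel g f.
Proof. by have [_ [g fK gK]] := isomP f; exists g. Qed.
Definition isom_inv_fun (f : isom) : X -> X := sval (cid (isom_inv_exists f)).

Lemma isom_funK (f : isom) : cancel f (isom_inv_fun f).
Proof. by rewrite /isom_inv_fun; case: cid => g []. Qed.
Lemma isom_inv_funK (f : isom) : cancel (isom_inv_fun f) f.
Proof. by rewrite /isom_inv_fun; case: cid => g []. Qed.

Fact isom_inv_subproof (f : isom) : `[< isometry (isom_inv_fun f) >].
Proof.
apply/asboolP; split=> [x y|].
  by rewrite -(isomP f).1 !isom_inv_funK.
by exists f; [exact: isom_inv_funK | exact: isom_funK].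
Qed.
Definition isom_inv (f : isom) := Isom (isom_inv_subproof f).

Fact isom_mulA : associative isom_mul.
Proof. by move=> f g h; exact: isom_eq. Qed.
Fact isom_mul1 : left_id isom_one isom_mul.
Proof. by move=> f; exact: isom_eq. Qed.
Fact isom_mulr1 : right_id isom_one isom_mul.
Proof. by move=> f; exact: isom_eq. Qed.
Fact isom_mulV : left_inverse isom_one isom_inv isom_mul.
Proof. by move=> f; apply: isom_eq => x /=; exact: isom_funK. Qed.
Fact isom_mulrV : right_inverse isom_one isom_inv isom_mul.
Proof. by move=> f; apply: isom_eq => x /=; exact: isom_inv_funK. Qed.

HB.instance Definition _ :=
  isGroup.Build isom isom_mulA isom_mul1 isom_mulr1 isom_mulV isom_mulrV.

End IsometryGroup.

Section RankOne.
Context {R : realType} {X : metricType R}.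

Definition asymptotic (c c' : R -> X) :=
  exists K : R, forall t, 0 <= t -> mdist (c t) (c' t) <= K.

(* A point of the geometric boundary is an asymptoty class of geodesic rays,
   represented by the set of its rays.  This is the class of [c]. *)
Definition boundary_point (c : R -> X) : set (R -> X) :=
  [set c' | geodesic_ray mdist c' /\ asymptotic c c'].

(* A flat half plane is an isometrically embedded closed Euclidean half plane
   {(s, t) | t >= 0}; its boundary line is parametrized by [c]. *)
Definition bounds_flat_half_plane (c : R -> X) :=
  exists f : R^o * R^o -> X,
    (forall x y, 0 <= x.2 -> 0 <= y.2 -> mdist (f x) (f y) = plane_dist x y) /\
    (forall s, f (s, 0) = c s).

(* Axes are oriented by the direction of translation. *)
Definition axis (g : isom X) (c : R -> X) :=
  geodesic_line mdist c /\ exists2 l : R, 0 < l & forall t, g (c t) = c (t + l).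

Definition rank_one_axis (g : isom X) (c : R -> X) :=
  axis g c /\ ~ bounds_flat_half_plane c.

Definition rank_one (g : isom X) := exists c, rank_one_axis g c.

(* The endpoints in the geometric boundary of an axis of [g]; all axes of a
   rank one isometry are parallel, hence have the same endpoints. *)
Definition fixed_endpoints (g : isom X) : set (set (R -> X)) :=
  \bigcup_(c in rank_one_axis g)
    [set boundary_point c; boundary_point (fun t => c (- t))].

Definition independent_rank_one (g h : isom X) :=
  [/\ rank_one g, rank_one h & fixed_endpoints g `&` fixed_endpoints h = set0].

End RankOne.

Section Growth.
Context {R : realType} {X1 X2 : metricType R}.
Implicit Types (G : groupClosed (isom X1 * isom X2)%type) (o : X1 * X2).

Definition prod_act (g : isom X1 * isom X2) (x : X1 * X2) : X1 * X2 :=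
  (g.1 x.1, g.2 x.2).

Definition acts_properly G :=
  forall (x : X1 * X2) (r : R), 0 < r ->
    finite_set [set g | g \in G /\ prod_dist x (prod_act g x) <= r].

Definition slope o (g : isom X1 * isom X2) : R :=
  if mdist o.1 (g.1 o.1) == 0 then pi / 2
  else atan (mdist o.2 (g.2 o.2) / mdist o.1 (g.1 o.1)).

Definition slope_annulus G o (eps theta : R) (n : nat) :
    set (isom X1 * isom X2) :=
  [set g | [/\ g \in G, prod_act g o <> o,
      n%:R - 1 <= prod_dist o (prod_act g o) < n%:R &
      `|slope o g - theta| <= eps]].

(* [lne 0 = -oo].  The value of the sequence at [n = 0] is irrelevant. *)
Definition growth_rate_eps G o (eps theta : R) : \bar R :=
  limn_esup (fun n : nat =>
    (lne (counting (slope_annulus G o eps theta n)) * (n%:R^-1)%:E)%E).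

Definition growth_rate G o (theta : R) : \bar R :=
  limf_einf (fun eps : R => growth_rate_eps G o eps theta) (0 : R)^'+.

Definition regular_growth G o :=
  forall theta : R, theta \in `[0, pi / 2] -> (0 <= growth_rate G o theta)%E.

End Growth.

(* Main.v *)
Require Import Defs.
From mathcomp Require Import all_boot all_order all_algebra.
From mathcomp Require Import all_classical all_reals all_analysis.
From mathcomp Require Import ring lra.

Set Implicit Arguments.
Unset Strict Implicit.
Unset Printing Implicit Defensive.
Import Order.TTheory GRing.Theory Num.Theory.
Import numFieldNormedType.Exports.

Local Open Scope classical_set_scope.
Local Open Scope ring_scope.

(** Write v(a) = (d1 (o1, a1 o1), d2 (o2, a2 o2)) for the displacement vector
    of a in G.  Two mechanisms produce many elements of slope close to theta.

    First, the powers of g and h play ping-pong simultaneously in both factors.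
    Words in g^N and h^N are therefore pairwise distinct, 2^m of them having
    length m, with displacements O(m) ([word_inj], [word_disp]).  Moreover, any
    two elements b, c of G can be joined by one of sixteen fixed elements e so
    that v(b e c) = v(b) + v(c) up to a uniform error ([generic_product]): e
    makes the Gromov product of b^-1 o and e c o bounded in both factors.

    Secondly, regular growth at the slopes 0 and pi/2 provides
    elements a and b of large displacement, as close to horizontal and to
    vertical as desired.  Generic products of p copies of a and q copies of b
    have displacement p v(a) + q v(b) up to a small relative error
    ([generic_powers]).  So each word w of length m can be completed, on the
    right, to an element whose displacement vector is close to
    K m (1, tan theta), with K independent of the desired precision
    ([correction]).  The completion depends on p, q and e only, hence on
    polynomially many data; some fibre of this choice is a set of at least
    2^m / poly(m) words to which the same element is appended, so that the
    products stay distinct ([many_elements]).  The exponential rate so obtained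
    is log 2 divided by a constant that does not depend on the aperture
    ([growth_rate_ge]).

    The geometric input is that the axis c of a rank one isometry is
    contracting ([rank_one_contracting]): a geodesic between two points whose
    projections to c lie far apart passes close to c in between.  Instead of
    projections and angles, everything is phrased with the convex functions
    t |-> d (y, c t) and their increments over unit intervals.  The key lemma
    [steep] says that if d (y, c -) is still non-increasing at time t, then at
    time t - B it decreases almost at unit speed, with B independent of y.
    Otherwise there are y such that d (y, c -) is almost affine on arbitrarily
    long intervals, with a slope bounded away from -1.  Translating these
    intervals back along the axis, the thin triangles formed by c and y converge
    to a flat sector bounded by c, and c bounds a flat half plane
    ([flat_half_plane_limit]).  Independence of the isometries enters through
    [asymptotic_of_ahead]: if there are points arbitrarily far ahead of two
    contracting lines, then the lines are asymptotic. *)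

(** * Comparison inequalities *)

Section Comparison.
Context {R : realType} (X : metricType R).
Implicit Types (x y z p q r : X) (c : R -> X).

Lemma mdist_triangle_sub x y z : `|mdist x y - mdist x z| <= mdist y z.
Proof.
have := metric_triangle x y z; have := metric_triangle x z y.
rewrite (metric_sym z y) ler_norml => h1 h2; apply/andP; split; lra.
Qed.

(** The cosine rule.  In the degenerate case of a side of length 0 any angle is
    a comparison angle, and the value 1 fits the formula, in which the fraction
    vanishes. *)
Lemma comparison_cos (a b d : R) : 0 <= a -> 0 <= b -> `|a - b| <= d ->
  d <= a + b ->
  exists k : R, [/\ -1 <= k, k <= 1, d ^+ 2 = a ^+ 2 + b ^+ 2 - 2 * a * b * k
    & forall s t : R, (a = 0 -> s = 0) -> (b = 0 -> t = 0) ->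
      s ^+ 2 + t ^+ 2 - 2 * s * t * k =
      (s - t) ^+ 2 + s * t / (a * b) * (d ^+ 2 - (a - b) ^+ 2)].
Proof.
move=> a0 b0 /ler_normlP[dl dr] du.
have [az|an] := eqVneq a 0.
  exists 1; split; [lra|lra| |]; last by move=> s t /(_ az) -> _; ring.
  have -> : d = b by lra.
  rewrite az.
  ring.
have [bz|bn] := eqVneq b 0.
  exists 1; split; [lra|lra| |]; last by move=> s t _ /(_ bz) ->; ring.
  have -> : d = a by lra.
  rewrite bz.
  ring.
have ap : 0 < a by rewrite lt_neqAle eq_sym an.
have bp : 0 < b by rewrite lt_neqAle eq_sym bn.
exists ((a ^+ 2 + b ^+ 2 - d ^+ 2) / (2 * a * b)); split.
- rewrite ler_pdivlMr; last by rewrite !mulr_gt0.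
  nra.
- rewrite ler_pdivrMr; last by rewrite !mulr_gt0.
  nra.
- by field; rewrite ?an ?bn.
- by move=> s t _ _; field; rewrite ?an ?bn.
Qed.

Lemma plane_distE (x y : R^o * R^o) :
  plane_dist x y = Num.sqrt ((x.1 - y.1) ^+ 2 + (x.2 - y.2) ^+ 2).
Proof.
rewrite /plane_dist /prod_dist /mdist /=.
by congr (Num.sqrt (_ + _)); rewrite real_normK ?num_real // -sqrrN opprB.
Qed.

Lemma sqrtr_eq (a b : R) : 0 <= b -> a = b ^+ 2 -> Num.sqrt a = b.
Proof. by move=> b0 ->; rewrite sqrtr_sqr ger0_norm. Qed.

(** The CAT(0) inequality with the distance in the comparison triangle computed
    from the lengths of the sides. *)
Lemma cat0_sqr p q r c1 c2 (s t : R) : cat0 X ->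
  geodesic mdist p q c1 -> geodesic mdist p r c2 ->
  0 <= s <= mdist p q -> 0 <= t <= mdist p r ->
  mdist (c1 s) (c2 t) ^+ 2 <= (s - t) ^+ 2 +
    s * t / (mdist p q * mdist p r) *
      (mdist q r ^+ 2 - (mdist p q - mdist p r) ^+ 2).
Proof.
move=> [_ catX] g1 g2 sI tI.
set a := mdist p q in sI g1 *; set b := mdist p r in tI g2 *;
  set d := mdist q r.
have a0 : 0 <= a by exact: mdist_ge0.
have b0 : 0 <= b by exact: mdist_ge0.
have dab : d <= a + b by rewrite /a metric_sym; exact: metric_triangle.
have [k [k1 k2 dE fE]] := comparison_cos a0 b0 (mdist_triangle_sub p q r) dab.
have w0 : 0 <= 1 - k ^+ 2 by nra.
pose w := Num.sqrt (1 - k ^+ 2).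
have wE : w ^+ 2 = 1 - k ^+ 2 by rewrite sqr_sqrtr.
(* The comparison triangle: the two sides at the vertex 0 are the segments from
   0 in the directions (1, 0) and (k, w). *)
pose e1 (u : R) : R^o * R^o := (u, 0).
pose e2 (u : R) : R^o * R^o := (u * k, u * w).
have e1d u v : plane_dist (e1 u) (e1 v) = `|u - v|.
  by rewrite plane_distE; apply: sqrtr_eq => //=;
    rewrite real_normK ?num_real//; ring.
have e2d u v : plane_dist (e2 u) (e2 v) = `|u - v|.
  rewrite plane_distE; apply: sqrtr_eq => //=; rewrite real_normK ?num_real//.
  have -> : (u * k - v * k) ^+ 2 + (u * w - v * w) ^+ 2 =
    (u - v) ^+ 2 * (k ^+ 2 + w ^+ 2) by ring.
  rewrite wE; ring.
have e12d u v :
    plane_dist (e1 u) (e2 v) = Num.sqrt (u ^+ 2 + v ^+ 2 - 2 * u * v * k).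
  rewrite plane_distE /=; congr Num.sqrt.
  have -> : (u - v * k) ^+ 2 + (0 - v * w) ^+ 2 =
    u ^+ 2 - 2 * u * v * k + v ^+ 2 * (k ^+ 2 + w ^+ 2) by ring.
  rewrite wE; ring.
have e20 : e2 0 = e1 0 by rewrite /e2 /e1 !mul0r.
have := catX p q r (e1 0) (e1 a) (e2 b) c1 c2 e1 e2.
rewrite e1d -{1}e20 e2d e12d !sub0r !normrN !ger0_norm//.
have dd : Num.sqrt (a ^+ 2 + b ^+ 2 - 2 * a * b * k) = d.
  by apply: sqrtr_eq; [exact: mdist_ge0 | rewrite dE].
have ge1 : geodesic (@plane_dist R) (e1 0) (e1 a) e1.
  by split => //; rewrite e1d sub0r normrN ger0_norm.
have ge2 : geodesic (@plane_dist R) (e1 0) (e2 b) e2.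
  by split => //; rewrite -e20 e2d sub0r normrN ger0_norm.
move=> /(_ erefl erefl dd g1 g2 ge1 ge2 s t).
rewrite !in_itv/= => /(_ sI tI); rewrite e12d.
case/andP: sI => s0 sa; case/andP: tI => t0 tb.
rewrite -fE; [|move=> a00; lra|move=> b00; lra].
move=> H; have H0 : 0 <= mdist (c1 s) (c2 t) := mdist_ge0 _ _.
have Q0 : 0 <= s ^+ 2 + t ^+ 2 - 2 * s * t * k.
  have -> : s ^+ 2 + t ^+ 2 - 2 * s * t * k = (s - t * k) ^+ 2 +
    t ^+ 2 * (1 - k ^+ 2) by ring.
  by apply: addr_ge0; [exact: sqr_ge0 | apply: mulr_ge0 => //; exact: sqr_ge0].
by rewrite -[leRHS]sqr_sqrtr// ler_sqr ?nnegrE.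
Qed.

Lemma geodesic_dist_start p q c (s : R) : geodesic mdist p q c ->
  0 <= s <= mdist p q -> mdist p (c s) = s.
Proof.
move=> [c0 _ cd] /andP[s0 sd];
  rewrite -[X in mdist X _]c0 cd ?in_itv/= ?s0 ?lexx//.
  by rewrite sub0r normrN ger0_norm.
exact: mdist_ge0.
Qed.

Lemma geodesic_dist_end p q c (s : R) : geodesic mdist p q c ->
  0 <= s <= mdist p q -> mdist (c s) q = mdist p q - s.
Proof.
move=> [_ c1 cd] /andP[s0 sd];
  rewrite -[X in mdist _ X]c1 cd ?in_itv/= ?s0 ?lexx ?andbT//.
  by rewrite distrC ger0_norm // subr_ge0.
exact: mdist_ge0.
Qed.

Hypothesis catX : cat0 X.

Lemma stewart p q y c (s : R) : geodesic mdist p q c -> 0 <= s <= mdist p q ->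
  mdist p q * mdist y (c s) ^+ 2 <= (mdist p q - s) * mdist y p ^+ 2 +
    s * mdist y q ^+ 2 - s * (mdist p q - s) * mdist p q.
Proof.
move=> gc sI; have [c2 g2] := catX.1 p y.
have b0 := mdist_ge0 p y; have a0 := mdist_ge0 p q.
case/andP: (sI) => s0 sa.
have [E|an] := eqVneq (mdist p q) 0.
  have sz : s = 0 by lra.
  by rewrite E sz; lra.
have [/mdist_positivity <-|bn] := eqVneq (mdist p y) 0.
  rewrite mdistxx (geodesic_dist_start gc)//; lra.
have := cat0_sqr catX gc g2 sI (t := mdist p y).
rewrite b0 lexx/= => /(_ isT); have [_ -> _] := g2.
rewrite (metric_sym (c s)) (metric_sym y p) (metric_sym y q).
rewrite -(ler_pM2l (x := mdist p q)); last by rewrite lt_neqAle eq_sym an.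
move/le_trans; apply; rewrite le_eqVlt; apply/orP; left; apply/eqP.
by field; rewrite ?an ?bn.
Qed.

(** Stewart's bound minus the square of the convex combination equals s (a - s)
    ((u - v)^2 - a^2) / a^2, where u, v are the distances from [y] to the ends
    and a is the length of the side; this is nonpositive by the triangle
    inequality. *)
Lemma mdist_convex p q y c (s : R) : geodesic mdist p q c ->
  0 <= s <= mdist p q ->
  mdist p q * mdist y (c s) <= (mdist p q - s) * mdist y p + s * mdist y q.
Proof.
move=> gc sI; have := stewart y gc sI; case/andP: sI => s0 sa.
have := mdist_ge0 y (c s); have := mdist_ge0 y p; have := mdist_ge0 y q.
have := mdist_triangle_sub y p q; rewrite ler_norml => /andP[].
move: (mdist p q) (mdist y p) (mdist y q) (mdist y (c s)) sa => a u v w sa.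
move=> h1 h2 v0 u0 w0 st.
have h : s * (a - s) * ((u - v) ^+ 2 - a ^+ 2) <= 0.
  apply: mulr_ge0_le0; first by rewrite mulr_ge0// subr_ge0.
  nra.
have a0 : 0 <= a by lra.
have r0 : 0 <= (a - s) * u + s * v by rewrite addr_ge0 ?mulr_ge0 ?subr_ge0.
rewrite -(@ler_sqr _ (a * w)) ?nnegrE ?mulr_ge0//.
have := ler_wpM2l a0 st.
nra.
Qed.

End Comparison.

(** * Convexity along a geodesic line *)

Section ConvexFunction.
Context {R : realType}.

Definition line_convex (f : R -> R) := forall t1 t t2 : R, t1 <= t -> t <= t2 ->
  (t2 - t1) * f t <= (t2 - t) * f t1 + (t - t1) * f t2.

Lemma line_convex_chord (f : R -> R) (a b a' b' : R) : line_convex f ->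
  a < b -> a' < b' -> a <= a' -> b <= b' ->
  (f b - f a) * (b' - a') <= (f b' - f a') * (b - a).
Proof.
move=> cf ab ab' aa bb.
have ab0 : 0 < b' - a by lra.
have h1 := cf a b b' (ltW ab) bb; have h2 := cf a a' b' aa (ltW ab').
have k1 : (f b - f a) * (b' - a) <= (f b' - f a) * (b - a) by lra.
have k2 : (f b' - f a) * (b' - a') <= (f b' - f a') * (b' - a) by lra.
have d1 : 0 <= b' - a' by lra.
have d2 : 0 <= b - a by lra.
rewrite -(ler_pM2l ab0).
have := ler_wpM2l d1 k1; have := ler_wpM2l d2 k2; lra.
Qed.

End ConvexFunction.

Section GeodesicLine.
Context {R : realType} (X : metricType R) (catX : cat0 X) (c : R -> X).
Hypothesis lc : geodesic_line mdist c.
Implicit Types (y : X) (s t : R).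

Lemma line_geodesic (t1 t2 : R) : t1 <= t2 ->
  geodesic mdist (c t1) (c t2) (fun u => c (t1 + u)).
Proof.
move=> t12; split; first by rewrite addr0.
  by rewrite lc distrC ger0_norm ?subr_ge0// addrC subrK.
by move=> s t _ _; rewrite lc; congr (`|_|); ring.
Qed.

Lemma line_dist (t1 t2 : R) : t1 <= t2 -> mdist (c t1) (c t2) = t2 - t1.
Proof. by move=> t12; rewrite lc distrC ger0_norm ?subr_ge0. Qed.

Lemma line_stewart y (t1 t t2 : R) : t1 <= t -> t <= t2 ->
  (t2 - t1) * mdist y (c t) ^+ 2 <= (t2 - t) * mdist y (c t1) ^+ 2 +
    (t - t1) * mdist y (c t2) ^+ 2 - (t - t1) * (t2 - t) * (t2 - t1).
Proof.
move=> h1 h2; have h := le_trans h1 h2.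
have := stewart catX y (line_geodesic h) (s := t - t1).
have -> : t1 + (t - t1) = t by ring.
rewrite line_dist// lerD2r h2 subr_ge0 h1 => /(_ isT).
lra.
Qed.

Lemma mdist_line_convex y : line_convex (fun t => mdist y (c t)).
Proof.
move=> t1 t t2 h1 h2; have h := le_trans h1 h2.
have := mdist_convex catX y (line_geodesic h) (s := t - t1).
have -> : t1 + (t - t1) = t by ring.
rewrite line_dist// lerD2r h2 subr_ge0 h1 => /(_ isT).
lra.
Qed.

End GeodesicLine.

Section Ahead.
Context {R : realType} (X : metricType R) (catX : cat0 X) (c : R -> X).
Hypothesis lc : geodesic_line mdist c.
Implicit Types (y : X) (s t : R).

(** By the first variation formula, the derivative of t |-> d (y, c t) is minus
    the cosine of the angle at [c t] between the ray towards [y] and the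
    positive direction of [c]; increments over unit intervals are a coarse
    substitute. *)
Definition step (c : R -> X) y t := mdist y (c (t + 1)) - mdist y (c t).

(** A coarse form of the condition that the projection of [y] to [c] has a
    parameter of at least [t]. *)
Definition ahead (c : R -> X) t := [set y : X | step c y t <= 0].

Lemma step_mono y (s t : R) : s <= t -> step c y s <= step c y t.
Proof.
move=> st.
have := line_convex_chord (a := s) (b := s + 1) (a' := t) (b' := t + 1)
  (mdist_line_convex catX lc y).
rewrite /step; have -> : s + 1 - s = 1 by ring.
have -> : t + 1 - t = 1 by ring.
by rewrite !mulr1; apply; lra.
Qed.

Lemma ahead_le y (s t : R) : s <= t -> ahead c t y -> ahead c s y.
Proof. by move=> st; rewrite /ahead/=; apply: le_trans; exact: step_mono. Qed.

Lemma step_left y (s t : R) : s <= t ->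
  mdist y (c t) - mdist y (c s) <= step c y t * (t - s).
Proof.
rewrite le_eqVlt => /predU1P[->|st]; first by rewrite !subrr mulr0.
have := @line_convex_chord _ _ s t t (t + 1) (mdist_line_convex catX lc y).
rewrite /step; have -> : t + 1 - t = 1 by ring.
by rewrite mulr1; apply; lra.
Qed.

Lemma step_right y (s t : R) : s + 1 <= t ->
  step c y s * (t - s - 1) <= mdist y (c t) - mdist y (c (s + 1)).
Proof.
rewrite le_eqVlt => /predU1P[<-|st]; first by rewrite !subrr; lra.
have := line_convex_chord (a := s) (b := s + 1) (a' := s + 1) (b' := t)
  (mdist_line_convex catX lc y).
rewrite /step; have -> : s + 1 - s = 1 by ring.
by rewrite mulr1 opprD addrA; apply; lra.
Qed.

Lemma ahead_anti y (s t : R) : ahead c t y -> s <= t ->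
  mdist y (c t) <= mdist y (c s).
Proof.
move=> ah st; have := step_left y st; rewrite /ahead/= in ah.
have : 0 <= t - s by lra.
nra.
Qed.

End Ahead.

(** * Limits along an ultrafilter *)

Section UltraLimit.

(** An ultrafilter replaces the extraction of a subsequence that converges for
    all members of an uncountable family at once. *)
Lemma ultra_cvg_compact (I : Type) (T : topologicalType) (F : set_system I)
    (f : I -> T) (K : set T) : UltraFilter F -> compact K -> F (f @^-1` K) ->
  exists2 p, K p & f @ F --> p.
Proof.
move=> UF cK FK; have [p [Kp clp]] := cK (f @ F) _ FK.
exists p => // V nV; have [//|FC] := in_ultra_setVsetC (f @^-1` V) UF.
have [z [nVz Vz]] := clp (~` V) V FC nV.
by case: nVz.
Qed.

Context {R : realType} (X : metricType R).

Lemma cvg_mdist (I : Type) (F : set_system I) (FF : Filter F)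
    (f g : I -> X) (x y : X) :
  f @ F --> x -> g @ F --> y -> mdist (f i) (g i) @[i --> F] --> mdist x y.
Proof.
move=> fx gy; apply/cvgrPdist_le => e e0.
have e2 : 0 < e / 2 by rewrite divr_gt0.
have Hf : \forall i \near F, mdist x (f i) <= e / 2.
  exact: metricType_numDomainType.cvgr_dist_le.
have Hg : \forall i \near F, mdist y (g i) <= e / 2.
  exact: metricType_numDomainType.cvgr_dist_le.
near=> i.
have h1 : mdist x (f i) <= e / 2 by near: i.
have h2 : mdist y (g i) <= e / 2 by near: i.
have := mdist_triangle_sub (f i) (g i) y; have := mdist_triangle_sub y x (f i).
rewrite (metric_sym y x) (metric_sym y (f i)) (metric_sym (g i) y).
rewrite !ler_norml => /andP[? ?] /andP[? ?]; apply/andP; split; lra.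
Unshelve. all: by end_near. Qed.

End UltraLimit.

(** * Flat half planes in oblique coordinates *)

Lemma sqr_ge0_inj (R : realType) (a b : R) : 0 <= a -> 0 <= b ->
  a ^+ 2 = b ^+ 2 -> a = b.
Proof. by move=> a0 b0 /eqP; rewrite eqrXn2// => /eqP. Qed.

(** Here [P t s] stands for the point at distance [s] from [c t] on a ray that
    issues from [c t], all these rays being asymptotic to each other.  In a
    Euclidean plane, if [k] is the cosine of the angle between the rays and the
    line, the distance from [P t s] to [P t' s'] is given by the quadratic form
    of [oblique].  Only an upper bound on these distances is assumed; equality
    follows because the points of [c] are on a line. *)
Section ObliqueFlat.
Context {R : realType} (X : metricType R) (catX : cat0 X) (c : R -> X).
Hypothesis lc : geodesic_line mdist c.
Variables (k : R) (P : R -> R -> X).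
Hypotheses (k1 : k ^+ 2 < 1) (k0 : 0 <= k).
Hypothesis P0 : forall t, P t 0 = c t.
Hypothesis Pc : forall t s, 0 <= s -> mdist (P t s) (c t) = s.
Hypothesis Ple : forall t s t' s' : R, 0 <= s -> 0 <= s' ->
  mdist (P t s) (P t' s') ^+ 2 <=
    (t - t') ^+ 2 + (s - s') ^+ 2 + 2 * k * (t - t') * (s - s').

Definition oblique (u v : R) := u ^+ 2 + v ^+ 2 + 2 * k * u * v.

Lemma oblique_ge0 u v : 0 <= oblique u v.
Proof.
have -> : oblique u v = (u + k * v) ^+ 2 + (1 - k ^+ 2) * v ^+ 2.
  by rewrite /oblique; ring.
apply: addr_ge0; first exact: sqr_ge0.
by apply: mulr_ge0; [rewrite subr_ge0 ltW | exact: sqr_ge0].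
Qed.

(** Stewart's inequality at the point [c t] between [c (t - e)] and [c (t + e)]
    bounds from below the sum of two quantities whose upper bounds have the same
    sum, so that both upper bounds are attained. *)
Lemma oblique_axis (t s t' : R) : 0 <= s ->
  mdist (P t s) (c t') ^+ 2 = oblique (t - t') s.
Proof.
move=> s0.
have H (e : R) : 0 < e -> mdist (P t s) (c (t + e)) ^+ 2 = oblique (- e) s /\
    mdist (P t s) (c (t - e)) ^+ 2 = oblique e s.
  move=> e0.
  have h1 := Ple t (t + e) s0 (lexx 0); have h2 := Ple t (t - e) s0 (lexx 0).
  rewrite P0 in h1; rewrite P0 in h2.
  have h3 := line_stewart catX lc (P t s) (t1 := t - e) (t := t) (t2 := t + e).
  have {}h3 := h3 ltac:(lra) ltac:(lra); rewrite Pc// in h3.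
  rewrite /oblique; move: h1 h2 h3.
  move: (mdist (P t s) (c (t + e)) ^+ 2) (mdist (P t s) (c (t - e)) ^+ 2) =>
    A B h1 h2 h3.
  have h4 : 2 * e * s ^+ 2 <= e * (B + A - 2 * e ^+ 2) by nra.
  have h5 : 2 * s ^+ 2 <= B + A - 2 * e ^+ 2.
    by rewrite -(ler_pM2l e0); lra.
  split; lra.
have [tt|tt|->] := ltgtP t t'.
- have e0 : 0 < t' - t by lra.
  have [+ _] := H _ e0; rewrite addrC subrK => ->.
  by congr oblique; ring.
- have e0 : 0 < t - t' by lra.
  have [_] := H _ e0; have -> : t - (t - t') = t' by ring.
  by [].
- by rewrite Pc// /oblique; ring.
Qed.

(** The straight line from (t', s') through (t, s) meets the line s = 0 at a
    parameter t1, and the distances to [c t1] are known from [oblique_axis]; the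
    triangle inequality gives the lower bound. *)
Lemma oblique_lt (t s t' s' : R) : 0 <= s -> s < s' ->
  oblique (t' - t) (s' - s) <= mdist (P t s) (P t' s') ^+ 2.
Proof.
move=> s0 ss.
have d0 : 0 < s' - s by lra.
pose l := s / (s' - s); pose q := Num.sqrt (oblique (t' - t) (s' - s)).
have l0 : 0 <= l by rewrite divr_ge0// ltW.
have lE : l * (s' - s) = s by rewrite /l; field; lra.
have q0 : 0 <= q by exact: sqrtr_ge0.
have qE : q ^+ 2 = oblique (t' - t) (s' - s) by rewrite sqr_sqrtr// oblique_ge0.
pose t1 := t - (t' - t) * l.
have E1 : mdist (P t s) (c t1) = l * q.
  apply: sqr_ge0_inj; [exact: mdist_ge0|exact: mulr_ge0|].
  rewrite oblique_axis// exprMn qE -[in LHS]lE /oblique /t1; ring.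
have E2 : mdist (P t' s') (c t1) = (1 + l) * q.
  apply: sqr_ge0_inj; [exact: mdist_ge0|by apply: mulr_ge0 => //; lra|].
  rewrite oblique_axis//; last lra.
  rewrite exprMn qE.
  have -> : oblique (t' - t1) s' = oblique (t' - t1) (l * (s' - s) + (s' - s)).
    by congr oblique; rewrite lE; ring.
  rewrite /oblique /t1; ring.
have := metric_triangle (P t' s') (P t s) (c t1);
  rewrite E1 E2 (metric_sym (P t' s')) => h.
have h' : q <= mdist (P t s) (P t' s') by lra.
by rewrite -qE ler_sqr// nnegrE// mdist_ge0.
Qed.

(** The line through two points with the same [s] is parallel to [c]; moving one
    of them away by [e] reduces this case to [oblique_lt]. *)
Lemma oblique_horizontal (t s t' : R) : 0 <= s -> t <= t' ->
  t' - t <= mdist (P t s) (P t' s).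
Proof.
move=> s0 tt; apply/ler_addgt0Pr => e e0.
have h := @oblique_lt t s t' (s + e) s0 ltac:(lra).
have h1 : mdist (P t' s) (P t' (s + e)) <= e.
  have := Ple t' t' s0 (_ : 0 <= s + e) => /(_ ltac:(lra)).
  have -> : (t' - t') ^+ 2 + (s - (s + e)) ^+ 2 +
    2 * k * (t' - t') * (s - (s + e)) = e ^+ 2 by ring.
  by rewrite ler_sqr// nnegrE ?mdist_ge0// ltW.
have h2 : t' - t <= mdist (P t s) (P t' (s + e)).
  rewrite -(@ler_sqr _ (t' - t)) ?nnegrE ?mdist_ge0 ?subr_ge0//.
  apply: le_trans h; rewrite /oblique.
  have : 0 <= k * (t' - t) * e by rewrite !mulr_ge0// ?subr_ge0// ltW.
  have := sqr_ge0 e.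
  have -> : s + e - s = e by ring.
  lra.
have := metric_triangle (P t s) (P t' s) (P t' (s + e)); lra.
Qed.

Lemma obliqueE (t s t' s' : R) : 0 <= s -> 0 <= s' ->
  mdist (P t s) (P t' s') ^+ 2 = oblique (t - t') (s - s').
Proof.
have obN u v : oblique (- u) (- v) = oblique u v by rewrite /oblique; ring.
move=> s0 s0'; apply/eqP; rewrite eq_le Ple//=.
have [ss|ss|->] := ltgtP s s'.
- have := @oblique_lt t s t' s' s0 ss.
  by rewrite -[oblique (t' - t) _]obN !opprB.
- by rewrite metric_sym; exact: oblique_lt.
- have -> : oblique (t - t') (s' - s') = `|t - t'| ^+ 2.
    by rewrite real_normK ?num_real// /oblique; ring.
  rewrite ler_sqr ?nnegrE ?mdist_ge0//.
  have [tt|tt] := leP t t'.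
    by rewrite distrC ger0_norm ?subr_ge0//; exact: oblique_horizontal.
  rewrite metric_sym ger0_norm; last by rewrite subr_ge0 ltW.
  by apply: oblique_horizontal => //; exact: ltW.
Qed.

Lemma oblique_flat_half_plane : bounds_flat_half_plane c.
Proof.
have w0 : 0 < 1 - k ^+ 2 by rewrite subr_gt0.
pose w := Num.sqrt (1 - k ^+ 2).
have wp : 0 < w by rewrite sqrtr_gt0.
have wE : w ^+ 2 = 1 - k ^+ 2 by rewrite sqr_sqrtr// ltW.
(* [P t s] has Cartesian coordinates (t + k s, w s). *)
exists (fun x => P (x.1 - k * (x.2 / w)) (x.2 / w)); split; last first.
  by move=> s /=; rewrite mul0r mulr0 subr0 P0.
move=> [a b] [a' b'] /= b0 b0'; rewrite plane_distE/=; apply/esym/sqrtr_eq;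
  first exact: mdist_ge0.
rewrite obliqueE; try by rewrite divr_ge0// ltW.
have wn : w != 0 by rewrite gt_eqF.
have bE : b = b / w * w by rewrite divfK.
have bE' : b' = b' / w * w by rewrite divfK.
move: (b / w) (b' / w) bE bE' => u v -> ->.
rewrite /oblique; have -> :
  (u * w - v * w) ^+ 2 = (u - v) ^+ 2 * w ^+ 2 by ring.
rewrite wE; ring.
Qed.

End ObliqueFlat.

(** * Limits of long thin triangles *)

Lemma cvg_sqr (R : realType) (I : Type) (F : set_system I) (FF : Filter F)
    (f : I -> R) (l : R) :
  f @ F --> l -> f i ^+ 2 @[i --> F] --> l ^+ 2.
Proof.
by move=> fl; rewrite expr2; under eq_fun do rewrite expr2; exact: cvgM.
Qed.

(** The triangles with vertex [y n] and opposite side c([-n, n]): the distance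
    to [y n] is almost affine along that side, with slope in [-k, 0]. *)
Section FlatLimit.
Context {R : realType} (X : metricType R) (catX : cat0 X) (c : R -> X).
Hypothesis properX : proper_space X.
Hypothesis lc : geodesic_line mdist c.
Variables (y : nat -> X) (k : R).
Hypothesis k1 : k < 1.
Hypothesis step_bnd : forall n (t : R), `|t| <= n%:R ->
  - k <= step c (y n) t <= 0.
Hypothesis step_osc : forall n (t : R), `|t| <= n%:R ->
  `|step c (y n) t - step c (y n) 0| <= n.+1%:R^-1.

Let psi n t := mdist (y n) (c t).

(** As k < 1, the triangle inequality between the ends of the side forces [y n]
    to be far away: the distance to [y n] decreases by at most k n over [-n, 0]
    and does not increase over [0, n]. *)
Lemma psi_large n : n%:R * (1 - k) <= 2 * psi n 0.
Proof.
case: n => [|n]; first by rewrite mul0r mulr_ge0// mdist_ge0.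
have n0 : 0 <= n%:R :> R by [].
have nE : n.+1%:R = n%:R + 1 :> R by rewrite -natr1.
have /andP[h1 _] : - k <= step c (y n.+1) (- n.+1%:R) <= 0.
  by apply: step_bnd; rewrite normrN ger0_norm.
have /andP[_ h2] : - k <= step c (y n.+1) n.+1%:R <= 0.
  by apply: step_bnd; rewrite ger0_norm.
have h3 : psi n.+1 n.+1%:R <= psi n.+1 0 by apply: ahead_anti.
have h4 := @step_right _ _ catX _ lc (y n.+1) (- n.+1%:R) 0 ltac:(lra).
have h5 := metric_triangle (c (- n.+1%:R)) (y n.+1) (c n.+1%:R).
rewrite line_dist// in h5; last lra.
rewrite (metric_sym (c (- n.+1%:R))) in h5.
move: h1 h2 h3 h4 h5; rewrite /step /psi.
move: (mdist _ (c (- n.+1%:R))) (mdist _ (c (n.+1%:R)))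
  (mdist _ (c (- n.+1%:R + 1))) (mdist (y n.+1) (c 0)).
rewrite nE => p1 p2 p3 p0 h1 _ h3 h4 h5.
have h6 : - k * n%:R <= (p3 - p1) * n%:R by apply: ler_wpM2r.
lra.
Qed.

Lemma psi_slope n (t : R) : `|t| + 1 <= n%:R ->
  `|psi n t - psi n 0 - step c (y n) 0 * t| <= `|t| * n.+1%:R^-1.
Proof.
move=> tn; have h0 : 0 <= n.+1%:R^-1 :> R by [].
move: (n.+1%:R^-1) h0 (@step_osc n) => h h0 osc.
have b (u : R) : `|u| <= n%:R -> step c (y n) 0 - h <= step c (y n) u
    /\ step c (y n) u <= step c (y n) 0 + h.
  by move=> /osc; rewrite ler_norml => /andP[? ?]; split; lra.
have n1 : 1 <= n%:R :> R by have := normr_ge0 t; lra.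
rewrite /psi; have [t0|t0] := leP 0 t.
  rewrite (ger0_norm t0) in tn *.
  have tm : `|t| <= n%:R by rewrite ger0_norm//; lra.
  have [_ b1] := b t tm.
  have [b2 _] := b (-1) ltac:(rewrite normrN1//).
  have h1 := step_left catX lc (y n) t0.
  have t1 : -1 + 1 <= t by lra.
  have h2 := step_right catX lc (y n) t1.
  move: h1 h2; have -> : -1 + 1 = 0 :> R by ring.
  have c1 := ler_wpM2l t0 b1; have c2 := ler_wpM2l t0 b2.
  by rewrite ler_norml => h1 h2; apply/andP; split; lra.
rewrite (ltr0_norm t0) in tn *.
have tm : `|t - 1| <= n%:R by rewrite ltr0_norm; lra.
have [b2 _] := b _ tm.
have t0' : 0 <= - t by lra.
have h1 := step_left catX lc (y n) (ltW t0).
have t1 : t - 1 + 1 <= 0 by lra.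
have h2 := step_right catX lc (y n) t1.
move: h1 h2; have -> : t - 1 + 1 = t by ring.
have c2 := ler_wpM2l t0' b2.
by rewrite ler_norml => h1 h2; apply/andP; split; lra.
Qed.

Variables (F : set_system nat) (UF : UltraFilter F) (ooF : \oo `<=` F).

Lemma psi_slope_cvg (m t : R) : step c (y n) 0 @[n --> F] --> m ->
  psi n t - psi n 0 @[n --> F] --> m * t.
Proof.
move=> cm.
have h0 : n.+1%:R^-1 @[n --> F] --> (0 : R).
  by apply: cvg_trans cvg_harmonic; apply: cvg_app.
have -> : (fun n => psi n t - psi n 0) =
    (fun n => (psi n t - psi n 0 - step c (y n) 0 * t) + step c (y n) 0 * t).
  by apply/funext => n; ring.
rewrite -[m * t]add0r; apply: cvgD; last by apply: cvgMl.
have hb : `|t| * n.+1%:R^-1 @[n --> F] --> (0 : R).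
  by rewrite -(mulr0 `|t|); apply: cvgMr.
apply/cvgr0Pnorm_le => e e0.
have he : \forall n \near F, `| `|t| * n.+1%:R^-1 | <= e.
  exact: cvgr0_norm_le.
near=> n.
apply: le_trans (psi_slope _) _.
  near: n; apply: ooF; exact: nbhs_infty_ger.
apply: le_trans (ler_norm _) _.
by near: n.
Unshelve. all: by end_near. Qed.

Lemma psi_near (t A : R) : \forall n \near F, A <= psi n t.
Proof.
apply: ooF; near=> n.
have h1 := psi_large n.
have h2 : 2 * (A + `|t|) / (1 - k) <= n%:R by near: n; exact: nbhs_infty_ger.
rewrite ler_pdivrMr in h2; last by rewrite subr_gt0.
have := mdist_triangle_sub (y n) (c 0) (c t);
  rewrite lc sub0r normrN ler_norml => /andP[_].
rewrite -/(psi n 0) -/(psi n t); lra.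
Unshelve. all: by end_near. Qed.

Lemma psi_cvgV (t : R) : (psi n t)^-1 @[n --> F] --> (0 : R).
Proof.
apply/gtr0_cvgV0; last by apply/cvgryPge; exact: psi_near.
have H1 := psi_near t 1; near=> n; apply: (@lt_le_trans _ _ 1) => //.
by near: n; exact: H1.
Unshelve. all: by end_near. Qed.

(** The rays of the flat sector are the limits of the segments from [c t] to [y
    n]. The comparison inequality at the vertex [y n], where the adjacent sides
    become infinitely long, gives the upper bounds on distances that are needed
    in oblique coordinates, the angle having cosine minus the limit of the
    slopes. *)
Lemma bounds_flat_half_plane_ultralimit : bounds_flat_half_plane c.
Proof.
have [m mI cm] : exists2 m, m \in `[- k, 0] & step c (y n) 0 @[n --> F] --> m.
  have [|m mI cm] := ultra_cvg_compact (f := fun n => step c (y n) 0) UF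
    (@segment_compact R (- k) 0).
    apply: filterS filterT => n _ /=.
    by rewrite in_itv/=; apply: step_bnd; rewrite normr0.
  by exists m.
have mb : - k <= m <= 0 by rewrite in_itv in mI.
have [K HK] := choice (fun nt : nat * R => catX.1 (y nt.1) (c nt.2)).
(* The geodesic [K (n, t)] starts at [y n], hence the parameter. *)
pose Pn t s n := K (n, t) (psi n t - s).
have gK n t : geodesic mdist (y n) (c t) (K (n, t)) by exact: HK (n, t).
have exP : forall ts : R * R, exists p : X,
    0 <= ts.2 -> Pn ts.1 ts.2 n @[n --> F] --> p.
  move=> [t s]; have [s0|s0] := leP 0 s; last by exists (c 0) => /= ?; lra.
  have [|p _ cp] := ultra_cvg_compact (f := Pn t s) UF (@properX (c t) s);
    last by exists p.
  have Hs := psi_near t s; near=> n => /=.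
  rewrite metric_sym (geodesic_dist_end (gK n t)) ?/psi.
    by rewrite -/(psi n t) opprB addrC subrK.
  rewrite -/(psi n t) lerBlDr lerDl s0 andbT subr_ge0.
  by near: n.
have [P HP] := choice exP.
have H2 : forall t s t' s' : R, 0 <= s -> 0 <= s' ->
    mdist (P (t, s)) (P (t', s')) ^+ 2 <=
    (t - t') ^+ 2 + (s - s') ^+ 2 + 2 * (- m) * (t - t') * (s - s').
  move=> t s t' s' s0 s0'.
  pose D n := psi n t - psi n t'.
  have cD : D n @[n --> F] --> m * (t - t').
    have -> : D = fun n => (psi n t - psi n 0) - (psi n t' - psi n 0).
      by apply/funext => n; rewrite /D; ring.
    by rewrite mulrBr; apply: cvgB; exact: psi_slope_cvg.
  pose A n := (D n - (s - s')) ^+ 2 +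
    (1 - s * (psi n t)^-1) * (1 - s' * (psi n t')^-1) *
      ((t - t') ^+ 2 - D n ^+ 2).
  have cA : A n @[n --> F] --> (m * (t - t') - (s - s')) ^+ 2 +
    (1 - s * 0) * (1 - s' * 0) * ((t - t') ^+ 2 - (m * (t - t')) ^+ 2).
    apply: cvgD; first by apply: cvg_sqr; apply: cvgB => //; exact: cvg_cst.
    apply: cvgM.
      by apply: cvgM; apply: cvgB; (try exact: cvg_cst); apply: cvgMr;
        exact: psi_cvgV.
    by apply: cvgB; [exact: cvg_cst | apply: cvg_sqr].
  have cd : mdist (Pn t s n) (Pn t' s' n) ^+ 2 @[n --> F] -->
      mdist (P (t, s)) (P (t', s')) ^+ 2.
    by apply: cvg_sqr; apply: cvg_mdist;
      [exact: (HP (t, s)) | exact: (HP (t', s'))].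
  have -> : (t - t') ^+ 2 + (s - s') ^+ 2 + 2 * (- m) * (t - t') * (s - s') =
    (m * (t - t') - (s - s')) ^+ 2 +
      (1 - s * 0) * (1 - s' * 0) * ((t - t') ^+ 2 - (m * (t - t')) ^+ 2).
    ring.
  apply: (ler_cvg_to cd cA).
  have Hs := psi_near t s; have Hs' := psi_near t' s'.
  have H1 := psi_near t 1; have H1' := psi_near t' 1.
  near=> n.
  have p1 : 1 <= psi n t by near: n.
  have p1' : 1 <= psi n t' by near: n.
  have p2 : s <= psi n t by near: n.
  have p2' : s' <= psi n t' by near: n.
  have := @cat0_sqr _ _ _ _ _ _ _ (psi n t - s) (psi n t' - s') catX (gK n t)
    (gK n t').
  rewrite -/(psi n t) -/(psi n t') !lerBlDr !lerDl s0 s0' !subr_ge0 p2 p2' =>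
    /(_ isT isT).
  move/le_trans; apply; rewrite lc real_normK ?num_real// le_eqVlt; apply/orP;
    left; apply/eqP.
  rewrite /A /D; field; apply/andP; split; lra.
have Pc : forall t s : R, 0 <= s -> mdist (P (t, s)) (c t) = s.
  move=> t s s0.
  have h : mdist (Pn t s n) (c t) @[n --> F] --> mdist (P (t, s)) (c t).
    by apply: cvg_mdist; [exact: (HP (t, s)) | exact: cvg_cst].
  have cs : mdist (Pn t s n) (c t) @[n --> F] --> s.
    apply: cvg_near_cst; have Hs := psi_near t s; near=> n.
    rewrite (geodesic_dist_end (gK n t)) -/(psi n t); first by ring.
    rewrite lerBlDr lerDl s0 andbT subr_ge0.
    by near: n.
  rewrite -(cvg_lim (@norm_hausdorff _ _) h).
  exact: (cvg_lim (@norm_hausdorff _ _) cs).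
apply: (@oblique_flat_half_plane _ _ catX c lc (- m) (fun t s => P (t, s)))
  => //.
- have k1' : 0 < 1 - k by rewrite subr_gt0.
  case/andP: mb => m1 m2; rewrite -subr_gt0.
  have -> : 1 - (- m) ^+ 2 = (1 - m) * (1 + m) by ring.
  by rewrite mulr_gt0//; lra.
- by rewrite oppr_ge0; case/andP: mb.
- by move=> t; apply: mdist_positivity; exact: Pc.
Unshelve. all: by end_near. Qed.

End FlatLimit.

(** * Axes of rank one isometries are contracting *)

Section Steep.
Context {R : realType} (X : metricType R) (catX : cat0 X) (c : R -> X).
Hypothesis properX : proper_space X.
Hypothesis lc : geodesic_line mdist c.

Lemma flat_half_plane_limit (y : nat -> X) (k : R) : k < 1 ->
  (forall n (t : R), `|t| <= n%:R -> - k <= step c (y n) t <= 0) ->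
  (forall n (t : R), `|t| <= n%:R ->
    `|step c (y n) t - step c (y n) 0| <= n.+1%:R^-1) ->
  bounds_flat_half_plane c.
Proof.
move=> k1 h1 h2.
have [F [UF ooF]] := @ultraFilterLemma nat \oo _.
exact: (bounds_flat_half_plane_ultralimit catX properX lc k1 h1 h2 UF ooF).
Qed.

Lemma small_increment (f : nat -> R) n : f 0%N - f n.+1 <= 1 ->
  exists2 j, (j <= n)%N & f j - f j.+1 <= n.+1%:R^-1.
Proof.
move=> fn; apply: contrapT => H.
have {}H j : (j <= n)%N -> n.+1%:R^-1 < f j - f j.+1.
  by move=> jn; rewrite ltNge; apply/negP => h; apply: H; exists j.
have S : forall j, (j <= n)%N -> j.+1%:R * n.+1%:R^-1 < f 0%N - f j.+1.
  elim=> [|j IH] jn; first by rewrite mul1r; exact: H.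
  have := H _ jn; have := IH (ltnW jn).
  rewrite -[j.+2%:R]natr1 mulrDl mul1r; move: (n.+1%:R^-1) => a; lra.
have := S n (leqnn n); rewrite divff// => h.
by have := lt_le_trans h fn; rewrite ltxx.
Qed.

Variables (g : isom X) (l : R).
Hypotheses (l0 : 0 < l) (gl : forall t, g (c t) = c (t + l)).

Lemma axis_shift (z : int) y : exists y', forall t,
  mdist y' (c t) = mdist y (c (t + z%:~R * l)).
Proof.
elim: z y => [y|n IH y|n IH y].
- by exists y => t; rewrite mul0r addr0.
- have [y' Hy'] := IH (isom_inv g y); exists y' => t.
  rewrite Hy' -(isomP g).1 /= isom_inv_funK gl; congr (mdist _ (c _)).
  by rewrite -!pmulrn -natr1; ring.
- have [y' Hy'] := IH (g y); exists y' => t.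
  rewrite Hy'.
  have -> : c (t + (- n%:Z)%:~R * l) = g (c (t + (- n.+1%:Z)%:~R * l)).
    by rewrite gl; congr c; rewrite !mulrNz -!pmulrn -natr1; ring.
  by rewrite (isomP g).1.
Qed.

(** Suppose that [step c y] stays in [-k, 0] on a very long interval ending at
    [t]. It is monotone, with total variation at most 1, so that it varies by
    at most 1/(n+1) on one of n+1 long subintervals. A power of [g] moves the
    middle of this subinterval close to [c 0], and for n going to infinity [c]
    is seen to bound a flat half plane. *)
Lemma steep (k : R) : ~ bounds_flat_half_plane c -> k < 1 ->
  exists2 B, 0 <= B & forall t y, ahead c t y -> step c y (t - B) <= - k.
Proof.
move=> nf k1; apply: contrapT => H.
have {}H (B : R) : 0 <= B -> exists ty : R * X,
    ahead c ty.1 ty.2 /\ - k < step c ty.2 (ty.1 - B).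
  move=> B0; apply: contrapT => H'; apply: H; exists B => // t y aty.
  by rewrite leNgt; apply/negP => h; apply: H'; exists (t, y).
suff /choice[y Hy] : forall n, exists y : X, forall t : R, `|t| <= n%:R ->
    - k <= step c y t <= 0 /\ `|step c y t - step c y 0| <= n.+1%:R^-1.
  by apply: nf; apply: (@flat_half_plane_limit y k) => // n t /Hy[].
move=> n.
(* The summand [l] absorbs the distance from the middle of the subinterval to a
   multiple of the translation length. *)
pose L := n%:R + l; have L0 : 0 <= L by rewrite addr_ge0// ltW.
have [|[t y]/= [aty sty]] := H (n.+1%:R * (2 * L)); first by rewrite !mulr_ge0.
pose tau j := t - j%:R * (2 * L).
have taum i j : (i <= j)%N -> tau j <= tau i.
  by move=> ij; rewrite lerD2l lerN2 ler_wpM2r ?mulr_ge0 ?ler_nat.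
have tau0 : tau 0%N = t by rewrite /tau mul0r subr0.
have [|j jn Hj] := @small_increment (fun j => step c y (tau j)) n.
  have k1' : 0 < 1 - k by rewrite subr_gt0.
  by rewrite tau0 -/(tau n.+1) in sty *; rewrite /ahead/= in aty; lra.
pose u := tau j - L.
have bnd (s : R) : u - L <= s -> s <= u + L ->
    [/\ - k <= step c y s, step c y s <= 0, step c y (tau j.+1) <= step c y s
      & step c y s <= step c y (tau j)].
  move=> s1 s2.
  have e1 : tau j.+1 = u - L by rewrite /u /tau -natr1; ring.
  have e2 : tau j = u + L by rewrite /u; ring.
  have m1 : step c y (tau j.+1) <= step c y s.
    by apply: step_mono => //; rewrite e1.
  have m2 : step c y s <= step c y (tau j).
    by apply: step_mono => //; rewrite e2.
  have m3 : step c y (tau n.+1) <= step c y (tau j.+1).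
    by apply: step_mono => //; exact: taum.
  have m4 : step c y (tau j) <= step c y t.
    by rewrite -[in leRHS]tau0; apply: step_mono => //; exact: taum.
  rewrite /ahead/= in aty; split => //.
    by apply: ltW; apply: lt_le_trans sty _; exact: le_trans m1.
  exact: le_trans (le_trans m2 m4) aty.
pose z := Num.floor (u / l).
have zl : z%:~R * l <= u by rewrite -ler_pdivlMr//; exact: Num.Theory.ge_floor.
have zu : u <= z%:~R * l + l.
  have := Num.Theory.lt_succ_floor (u / l);
    rewrite -/z ltr_pdivrMr// intrD mulrDl mul1r; exact: ltW.
have [y' Hy'] := axis_shift z y; exists y' => s sn.
have stepE (v : R) : step c y' v = step c y (v + z%:~R * l).
  by rewrite /step !Hy'; congr (mdist _ (c _) - _); ring.
rewrite !stepE add0r; move: sn; rewrite ler_norml => /andP[sn1 sn2].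
have n0 : 0 <= n%:R :> R by [].
have [b1 b2 b3 b4] := bnd (s + z%:~R * l)
  ltac:(rewrite /L; lra) ltac:(rewrite /L; lra).
have [c1 c2 c3 c4] := bnd (z%:~R * l)
  ltac:(rewrite /L; lra) ltac:(rewrite /L; lra).
rewrite b1 b2; split => //.
move: Hj b3 b4 c3 c4; move: (n.+1%:R^-1) => h Hj b3 b4 c3 c4.
by rewrite ler_norml; apply/andP; split; lra.
Qed.

End Steep.

Section Contracting.
Context {R : realType} (X : metricType R) (catX : cat0 X).
Implicit Types (c : R -> X) (x y z w : X).

Definition reverse c : R -> X := fun t => c (- t).

Lemma reverseK c : reverse (reverse c) = c.
Proof. by apply/funext => t; rewrite /reverse opprK. Qed.

Lemma geodesic_line_rev c : geodesic_line mdist c ->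
  geodesic_line mdist (reverse c).
Proof. by move=> lc s t; rewrite /reverse lc -normrN; congr (`|_|); ring. Qed.

Lemma step_rev c y (t : R) : step (reverse c) y t = - step c y (- t - 1).
Proof.
rewrite /step /reverse opprB.
by congr (mdist _ (c _) - mdist _ (c _)); ring.
Qed.

Lemma bounds_flat_half_plane_rev c : bounds_flat_half_plane (reverse c) ->
  bounds_flat_half_plane c.
Proof.
move=> [f [fd fc]]; exists (fun a => f (- a.1, a.2)); split; last first.
  by move=> s /=; rewrite fc /reverse opprK.
move=> a b a0 b0; rewrite fd// !plane_distE/=; congr (Num.sqrt (_ + _)); ring.
Qed.

(** The bound 31/32 corresponds to an angle small enough for the estimate of
    [junction], where the loss is 1 - 31/32 + 1/4 < 1/2. *)
Definition steep_from (B : R) c := forall t y, ahead c t y ->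
  step c y (t - B) <= - (31 / 32).

(** From [c (t + B)] the point [x] lies almost exactly in the negative
    direction of the line and [y] in the positive one. The point at distance 1
    towards [y] is then within 1/4 of [c (t + B + 1)], so the distance to [x]
    grows at a rate of at least 1/2 over the first unit towards [y], hence, by
    convexity, all the way to [y]. The point of the estimate is that there is
    no loss proportional to d (x, c (t + B)). *)
Lemma junction c (B : R) x y (t : R) : geodesic_line mdist c -> 0 <= B ->
  steep_from B c -> steep_from B (reverse c) ->
  ahead (reverse c) (- t - 1) x -> ahead c (t + 2 * B) y ->
  mdist x (c (t + B)) + mdist (c (t + B)) y / 2 - 2 <= mdist x y.
Proof.
move=> lc B0 sc sr /sr xr /sc ys; pose t1 := t + B; rewrite -/t1.
have {}xr : 31 / 32 <= step c x t1.
  move: xr; rewrite step_rev lerN2.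
  by congr (_ <= step c x _); rewrite /t1; ring.
have {}ys : step c y t1 <= - (31 / 32).
  by move: ys; congr (step c y _ <= _); rewrite /t1; ring.
rewrite /step in xr ys.
set a := mdist x (c t1) in xr *; set e := mdist (c t1) y.
have a0 : 0 <= a := mdist_ge0 _ _.
rewrite (metric_sym y (c t1)) -/e in ys.
have [e1|e1] := leP e 1.
  have := metric_triangle x y (c t1).
  by rewrite (metric_sym y (c t1)) -/a -/e; lra.
have [s gs] := catX.1 (c t1) y.
have t11 : t1 <= t1 + 1 by lra.
have gl := line_geodesic lc t11.
have dl : mdist (c t1) (c (t1 + 1)) = 1 by rewrite line_dist//; ring.
have I1 : 0 <= (1 : R) <= mdist (c t1) y by rewrite -/e ler01 ltW.
have I2 : 0 <= (1 : R) <= mdist (c t1) (c (t1 + 1)) by rewrite dl ler01 lexx.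
have := cat0_sqr catX gs gl I1 I2.
rewrite dl -/e subrr expr0n/= add0r !mulr1 mul1r => h.
have := mdist_convex catX x gs I1; rewrite -/e -/a mul1r => h2.
have := metric_triangle x (s 1) (c (t1 + 1)) => h3.
have w0 : 0 <= mdist (s 1) (c (t1 + 1)) := mdist_ge0 _ _.
have w1 : mdist (s 1) (c (t1 + 1)) <= 1 / 4.
  rewrite -ler_sqr ?nnegrE//; apply: le_trans h _.
  rewrite mulrC ler_pdivrMr; last lra.
  have p0 : 0 <= mdist y (c (t1 + 1)) := mdist_ge0 _ _.
  have : mdist y (c (t1 + 1)) ^+ 2 <= (e - 31 / 32) ^+ 2.
    by rewrite ler_sqr ?nnegrE; lra.
  lra.
have h4 : a + 1 / 2 <= mdist x (s 1) by lra.
have e0 : 0 <= e by lra.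
have := ler_wpM2l e0 h4; lra.
Qed.

Lemma geodesic_ivt x w (s : R -> X) c (u : R) : geodesic mdist x w s ->
  step c w u <= 0 <= step c x u ->
  exists2 r, 0 <= r <= mdist x w & step c (s r) u = 0.
Proof.
move=> gs /andP[h1 h2]; have d0 := mdist_ge0 x w; have [s0 s1 sd] := gs.
have [|||r rI E] := @IVT R (fun r => step c (s r) u) 0 (mdist x w) 0 => //;
  last 2 first.
- by rewrite s0 s1 ge_min h1 orbT le_max h2.
- by exists r => //; rewrite in_itv in rI.
apply/subspace_continuousP => r rI; apply/cvgrPdist_le => e e0.
near=> z.
have zI : z \in `[0, mdist x w] by near: z; exact: withinT.
have rz : `|r - z| <= e / 2.
  near: z; apply: cvg_within; near=> z.
  by apply: ltW; near: z; apply: nbhsx_ballx; rewrite divr_gt0.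
have drz : mdist (s r) (s z) = `|r - z| by apply: sd; rewrite // inE.
rewrite /step.
have := mdist_triangle_sub (c u) (s r) (s z).
have := mdist_triangle_sub (c (u + 1)) (s r) (s z).
rewrite drz !(metric_sym (c _)) !ler_norml => /andP[a1 a2] /andP[a3 a4].
rewrite /from_subspace/=; apply/andP; split; lra.
Unshelve. all: by end_near. Qed.

(** On the geodesic from [x] to [w] there is a point [y] that is level with the
    middle u of the gap.  Applying [junction] on both sides of [y],
    d (x, w) = d (x, y) + d (y, w) exceeds the length of the detour through the
    line by a multiple of the distance from [y] to the line, up to a constant;
    the triangle inequality bounds this distance. *)
Lemma contracting_of_steep c (B : R) : geodesic_line mdist c -> 0 <= B ->
  steep_from B c -> steep_from B (reverse c) ->
  forall (t : R) x w s, ~ ahead c t x -> ahead c (t + 4 * B) w ->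
    geodesic mdist x w s ->
  exists2 r, 0 <= r <= mdist x w & mdist (s r) (c t) <= 5 * B + 10.
Proof.
move=> lc B0 sc sr t x w s /negP; rewrite -ltNge => xt wt gs.
pose u := t + 2 * B.
have [|r rI E] := @geodesic_ivt _ _ _ c u gs.
  apply/andP; split; first by apply: (ahead_le catX lc _ wt); rewrite /u; lra.
  by apply: le_trans (ltW xt) _; apply: step_mono => //; rewrite /u; lra.
exists r => //; set y := s r in E *.
have J1 : mdist x (c (t + B)) + mdist (c (t + B)) y / 2 - 2 <= mdist x y.
  apply: junction => //; last by rewrite /ahead/= -/u E.
  rewrite /ahead/= step_rev oppr_le0.
  by have -> : - (- t - 1) - 1 = t; [ring | exact: ltW].
have J2 : mdist w (c (u + 1 + B)) + mdist (c (u + 1 + B)) y / 2 - 2 <=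
    mdist w y.
  have -> : c (u + 1 + B) = reverse c ((- u - 1 - 2 * B) + B).
    by rewrite /reverse; congr c; ring.
  apply: junction => //; rewrite ?reverseK//; first exact: geodesic_line_rev.
    by move: wt; congr (ahead c _ w); rewrite /u; ring.
  rewrite /ahead/= step_rev.
  have -> : - (- u - 1 - 2 * B + 2 * B) - 1 = u by ring.
  by rewrite E oppr0.
have dxw : mdist x y + mdist w y = mdist x w.
  rewrite (geodesic_dist_start gs)// (metric_sym w) (geodesic_dist_end gs)//;
    ring.
have d1 : mdist (c (t + B)) (c (u + 1 + B)) = 2 * B + 1.
  by rewrite line_dist// /u; [ring|lra].
have d2 : mdist (c t) (c (t + B)) = B by rewrite line_dist//; [ring|lra].
have T1 := metric_triangle x (c (t + B)) w.
have T2 := metric_triangle (c (t + B)) (c (u + 1 + B)) w.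
have T3 := metric_triangle (c t) (c (t + B)) y.
have p := mdist_ge0 (c (u + 1 + B)) y.
rewrite (metric_sym w (c _)) in J2; rewrite (metric_sym y (c t)).
lra.
Qed.

End Contracting.

Section RankOneAxis.
Context {R : realType} (X : metricType R).
Context (catX : cat0 X) (properX : proper_space X).
Implicit Types (c : R -> X) (x y z w o : X) (g : isom X).

Definition contracting c (B D : R) := forall (t : R) x w s,
  ~ ahead c t x -> ahead c (t + B) w -> geodesic mdist x w s ->
  exists2 r, 0 <= r <= mdist x w & mdist (s r) (c t) <= D.

Lemma isomVK g x : (g^-1)%g (g x) = x.
Proof. exact: isom_funK. Qed.

Lemma axis_rev g c : axis g c -> axis (g^-1)%g (reverse c).
Proof.
move=> [lc [l l0 gl]]; split; first exact: geodesic_line_rev.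
exists l => // t; rewrite /reverse; have -> : - t = - (t + l) + l by ring.
by rewrite -gl isomVK.
Qed.

Lemma rank_one_axis_rev g c : rank_one_axis g c ->
  rank_one_axis (g^-1)%g (reverse c).
Proof.
move=> [ag nf]; split; first exact: axis_rev.
by move=> /bounds_flat_half_plane_rev.
Qed.

Lemma rank_one_steep g c : rank_one_axis g c ->
  exists2 B : R, 0 <= B & steep_from B c.
Proof.
move=> [[lc [l l0 gl]] nf].
by apply: (steep catX properX lc l0 gl nf); lra.
Qed.

Lemma steep_from_le c (B B' : R) : geodesic_line mdist c -> B <= B' ->
  steep_from B c -> steep_from B' c.
Proof.
move=> lc BB sc t y /sc; apply: le_trans; apply: step_mono => //; lra.
Qed.

Lemma rank_one_contracting g c : rank_one_axis g c ->
  exists B D, [/\ 0 <= B, 0 <= D & contracting c B D].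
Proof.
move=> rg; have [B1 B10 s1] := rank_one_steep rg.
have [B2 B20 s2] := rank_one_steep (rank_one_axis_rev rg).
have lc := rg.1.1; have lr := geodesic_line_rev lc.
exists (4 * (B1 + B2)), (5 * (B1 + B2) + 10); split; [lra|lra|].
apply: (contracting_of_steep catX lc); first lra.
- by apply: steep_from_le s1 => //; lra.
- by apply: steep_from_le s2 => //; lra.
Qed.

(** * Separation of the endpoints of axes *)

Lemma ahead_far c o (t : R) : geodesic_line mdist c -> 2 * mdist o (c 0) < t ->
  ~ ahead c t o.
Proof.
move=> lc ot ah; have d0 := mdist_ge0 o (c 0); have t0 : 0 <= t by lra.
have := ahead_anti catX lc ah t0; have := metric_triangle (c 0) o (c t).
rewrite line_dist// (metric_sym (c 0)); lra.
Qed.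

(** The square of the distance to a line is strictly convex, so it cannot be
    as large at the middle of a segment as at both ends. *)
Lemma ahead_rev_disjoint c z (T : R) : geodesic_line mdist c -> 0 < T ->
  ahead c T z -> ahead (reverse c) T z -> False.
Proof.
move=> lc T0 h1 h2; have lr := geodesic_line_rev lc.
have := ahead_anti catX lc h1 (ltW T0); have := ahead_anti catX lr h2 (ltW T0).
rewrite /reverse oppr0 => d1 d2.
have := @line_stewart _ _ catX _ lc z (- T) 0 T ltac:(lra) ltac:(lra).
have p0 := mdist_ge0 z (c 0); have p1 := mdist_ge0 z (c T);
  have p2 := mdist_ge0 z (c (- T)).
have q1 : mdist z (c T) ^+ 2 <= mdist z (c 0) ^+ 2 by rewrite ler_sqr ?nnegrE.
have q2 : mdist z (c (- T)) ^+ 2 <= mdist z (c 0) ^+ 2.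
  by rewrite ler_sqr ?nnegrE.
have := ler_wpM2l (ltW T0) q1; have := ler_wpM2l (ltW T0) q2.
have : 0 < T * T * T by rewrite !mulr_gt0.
lra.
Qed.

(** The geodesic from [o] to a point [z] far ahead of both lines passes close to
    [c t] and to [c' t], at parameters that differ little from t. *)
Lemma asymptotic_of_ahead c c' (B D B' D' : R) o :
  geodesic_line mdist c -> geodesic_line mdist c' ->
  0 <= B -> 0 <= D -> 0 <= B' -> 0 <= D' ->
  contracting c B D -> contracting c' B' D' ->
  (forall T : R, exists2 z, ahead c T z & ahead c' T z) -> asymptotic c c'.
Proof.
move=> lc lc' B0 D0 B0' D0' cc cc' H.
pose m := mdist o (c 0); pose m' := mdist o (c' 0).
have m0 : 0 <= m := mdist_ge0 _ _; have m0' : 0 <= m' := mdist_ge0 _ _.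
exists (5 * (m + m' + 1) + 2 * D + 2 * D') => t t0.
have dc := line_dist lc t0; have dc' := line_dist lc' t0.
have T1 := metric_triangle (c t) (c 0) o;
  have T2 := metric_triangle (c t) o (c' 0).
have T3 := metric_triangle (c t) (c' 0) (c' t).
have [tl|tl] := leP t (2 * (m + m' + 1)).
  rewrite metric_sym in dc; rewrite (metric_sym (c 0) o) -/m in T1.
  rewrite -/m' in T2; lra.
have [z z1 z2] := H (t + B + B').
have [s gs] := catX.1 o z.
have [r rI dr] : exists2 r, 0 <= r <= mdist o z & mdist (s r) (c t) <= D.
  apply: cc gs; first by apply: ahead_far => //; rewrite -/m; lra.
  by apply: (ahead_le catX lc _ z1); lra.
have [r' rI' dr'] : exists2 r, 0 <= r <= mdist o z & mdist (s r) (c' t) <= D'.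
  apply: cc' gs; first by apply: ahead_far => //; rewrite -/m'; lra.
  by apply: (ahead_le catX lc' _ z2); lra.
have E := geodesic_dist_start gs rI; have E' := geodesic_dist_start gs rI'.
have drr : mdist (s r) (s r') = `|r - r'|.
  by have [_ _] := gs; apply; rewrite in_itv.
have U1 := metric_triangle (c t) (s r) (c' t);
  have U2 := metric_triangle (s r) (s r') (c' t).
have V1 := mdist_triangle_sub o (s r) (c t);
  have V2 := mdist_triangle_sub (c t) o (c 0).
have V1' := mdist_triangle_sub o (s r') (c' t);
  have V2' := mdist_triangle_sub (c' t) o (c' 0).
rewrite (metric_sym (c t) (c 0)) dc (metric_sym (c t) o) -/m in V2.
rewrite (metric_sym (c' t) (c' 0)) dc' (metric_sym (c' t) o) -/m' in V2'.
rewrite E in V1; rewrite E' in V1'; rewrite (metric_sym (c t) (s r)) in U1.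
have drb : `|r - r'| <= D + D' + m + m'.
  move: V1 V2 V1' V2'; rewrite !ler_norml =>
    /andP[? ?] /andP[? ?] /andP[? ?] /andP[? ?].
  by apply/andP; split; lra.
lra.
Qed.

Lemma asymptotic_sym c c' : asymptotic c c' -> asymptotic c' c.
Proof. by move=> [K HK]; exists K => t /HK; rewrite metric_sym. Qed.

Lemma asymptotic_trans c1 c2 c3 : asymptotic c1 c2 -> asymptotic c2 c3 ->
  asymptotic c1 c3.
Proof.
move=> [K HK] [L HL]; exists (K + L) => t t0.
exact: le_trans (metric_triangle _ (c2 t) _) (lerD (HK _ t0) (HL _ t0)).
Qed.

Lemma boundary_point_eq c c' : asymptotic c c' ->
  boundary_point c = boundary_point c'.
Proof.
move=> a; apply/seteqP; split => d [rd ad]; split => //.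
  exact: asymptotic_trans (asymptotic_sym a) ad.
exact: asymptotic_trans a ad.
Qed.

End RankOneAxis.

(** * Ping-pong in one factor *)

Section PingPong.
Context {R : realType}.

Lemma uniform_bound (I : finType) (P : I -> R -> Prop) :
  (forall i, exists T, forall T', T <= T' -> P i T') ->
  exists T, forall T', T <= T' -> forall i, P i T'.
Proof.
move=> H; have [f Hf] := choice H; exists (\sum_i `|f i|) => T' TT i.
apply: Hf; apply: le_trans (ler_norm _) (le_trans _ TT).
by rewrite (bigD1 i)//= lerDl; apply: sumr_ge0 => j _; exact: normr_ge0.
Qed.

(** The four letters g, h, g^-1, h^-1 are indexed by pairs of booleans, the
    first selecting g or h and the second the sign of the exponent. *)
Definition letter (G : groupType) (g h : G) (p : bool * bool) : G :=
  let x := if p.1 then g else h in if p.2 then x else (x^-1)%g.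

Definition inv_letter (p : bool * bool) := (p.1, ~~ p.2).

Lemma inv_letterK : involutive inv_letter.
Proof. by case=> a b; rewrite /inv_letter /= negbK. Qed.

Variables (X : metricType R) (o : X).

(** [U p] is a neighbourhood of the attracting endpoint of [a p]. The last
    clause says that the Gromov product at [o] of a point outside [U p] and of
    a point pushed deep into [U p] is bounded by kap / 2. *)
Definition ping_pong (a : bool * bool -> isom X) (U : bool * bool -> set X)
    (kap : R) (N0 : nat) :=
  [/\ forall p q z, U p z -> U q z -> p = q,
      forall p, ~ U p o,
      forall p n z, (N0 <= n)%N -> ~ U (inv_letter p) z ->
        U p ((a p ^+ n)%g z) &
      forall p n x z, (N0 <= n)%N -> ~ U p x -> ~ U (inv_letter p) z ->
        mdist x o + mdist o ((a p ^+ n)%g z) - kap <= mdist x ((a p ^+ n)%g z)].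

Lemma ping_pong_le a U kap N0 N1 : (N0 <= N1)%N -> ping_pong a U kap N0 ->
  ping_pong a U kap N1.
Proof.
move=> NN [h1 h2 h3 h4]; split => // p n.
  by move=> z /(leq_trans NN); exact: h3.
by move=> x z /(leq_trans NN); exact: h4.
Qed.

Hypotheses (catX : cat0 X) (properX : proper_space X).

Lemma axis_pow (g : isom X) (c : R -> X) (l : R) n z t :
  (forall t, g (c t) = c (t + l)) ->
  mdist ((g ^+ n)%g z) (c (t + n%:R * l)) = mdist z (c t).
Proof.
move=> gl; elim: n z t => [|n IH] z t; first by rewrite mul0r addr0.
rewrite expgS -[LHS]/(mdist (g ((g ^+ n)%g z)) _).
have -> : c (t + n.+1%:R * l) = g (c (t + n%:R * l)).
  by rewrite gl -natr1; congr c; ring.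
by rewrite (isomP g).1 IH.
Qed.

Lemma contracting_mdist c (B D : R) x w (t : R) : contracting c B D ->
  ~ ahead c t x -> ahead c (t + B) w ->
  mdist x o + mdist o w - (2 * D + 2 * mdist o (c t)) <= mdist x w.
Proof.
move=> cc xt wt; have [s gs] := catX.1 x w.
have [r rI dr] := cc _ _ _ _ xt wt gs.
have E1 := geodesic_dist_start gs rI; have E2 := geodesic_dist_end gs rI.
have T1 := metric_triangle x (s r) o; have T2 := metric_triangle o (s r) w.
have T3 := metric_triangle (s r) (c t) o.
rewrite (metric_sym (c t) o) in T3; rewrite (metric_sym o (s r)) in T2.
lra.
Qed.

(** Take for [U p] the points ahead of parameter T of the axis of the letter p,
    oriented by its translation.  A point outside [U (inv_letter p)] is ahead of
    parameter -T - 1 of the axis of p, so that a power of the letter moves it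
    ahead of T + B; contraction then bounds the Gromov product. *)
Lemma ping_pong_exists (g h : isom X) : independent_rank_one g h ->
  exists U kap N0, ping_pong (letter g h) U kap N0.
Proof.
move=> [[cg rg] [ch rh] disj].
pose c (p : bool * bool) :=
  let x := if p.1 then cg else ch in if p.2 then x else reverse x.
have rc p : rank_one_axis (letter g h p) (c p).
  by case: p => [[] []] //; exact: rank_one_axis_rev.
have lc p : geodesic_line mdist (c p) := (rc p).1.1.
have cinv p : c (inv_letter p) = reverse (c p).
  by case: p => [b []] //; exact: (esym (reverseK (c (b, true)))).
have /choice[BD HBD] : forall p, exists BD : R * R,
    [/\ 0 <= BD.1, 0 <= BD.2 & contracting (c p) BD.1 BD.2].
  move=> p; have [B [D H]] := rank_one_contracting catX properX (rc p).
  by exists (B, D).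
have /choice[l Hl] : forall p, exists l : R,
    0 < l /\ forall t, (letter g h p) (c p t) = c p (t + l).
  by move=> p; have [[_ [l l0 gl]] _] := rc p; exists l.
have nasym p q : p.1 != q.1 -> ~ asymptotic (c p) (c q).
  move=> pq /boundary_point_eq E.
  have F p' : p'.1 = true -> fixed_endpoints g (boundary_point (c p')).
    by case: p' => [[] b] // _; exists cg => //; case: b; [left|right].
  have F' p' : p'.1 = false -> fixed_endpoints h (boundary_point (c p')).
    by case: p' => [[] b] // _; exists ch => //; case: b; [left|right].
  suff [e] : fixed_endpoints g `&` fixed_endpoints h !=set0.
    by rewrite disj.
  case: p q pq E => [[] b] [[] b'] //= _ E.
  - exists (boundary_point (c (true, b))).
    by split; [exact: F | rewrite E; exact: F'].
  - exists (boundary_point (c (true, b'))).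
    by split; [exact: F | rewrite -E; exact: F'].
have H1 (p : bool * bool) : exists T : R, forall T', T <= T' ->
    ~ ahead (c p) T' o.
  exists (2 * mdist o (c p 0) + 1) => T' TT; apply: ahead_far => //; lra.
have H2 (pq : (bool * bool) * (bool * bool)) : exists T : R,
    forall T', T <= T' ->
    forall z, ahead (c pq.1) T' z -> ahead (c pq.2) T' z -> pq.1 = pq.2.
  case: pq => p q /=; have [<-|pq] := eqVneq p q; first by exists 0.
  have [pq1|pq1] := eqVneq p.1 q.1.
    have qE : q = inv_letter p.
      case: p q pq pq1 => [a b] [a' b'] /= + E; rewrite /inv_letter/= E.
      by case: b b' => [] [] //=; rewrite ?eqxx.
    exists 1 => T' TT z; rewrite qE cinv => h1 h2; exfalso.
    by apply: (ahead_rev_disjoint catX (lc p) _ h1 h2); lra.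
  apply: contrapT => H; apply: (nasym _ _ pq1).
  have [b1 d1 k1] := HBD p; have [b2 d2 k2] := HBD q.
  apply: (asymptotic_of_ahead catX o (lc p) (lc q) b1 d1 b2 d2 k1 k2) => T.
  apply: contrapT => H'; apply: H; exists T => T' TT z h1 h2; exfalso.
  apply: H'; exists z; first exact: (ahead_le catX (lc p) TT).
  exact: (ahead_le catX (lc q) TT).
have [T1 HT1] := uniform_bound H1; have [T2 HT2] := uniform_bound H2.
pose T := `|T1| + `|T2|.
have HT1' : forall p, ~ ahead (c p) T o.
  by apply: HT1; rewrite /T; have := ler_norm T1; have := normr_ge0 T2; lra.
have HT2' : forall p q z, ahead (c p) T z -> ahead (c q) T z -> p = q.
  move=> p q; apply: (HT2 T _ (p, q)).
  by rewrite /T; have := ler_norm T2; have := normr_ge0 T1; lra.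
have [N HN] : exists N : R, forall N', N <= N' ->
    forall p, 2 * T + 1 + (BD p).1 <= N' * l p.
  apply: uniform_bound => p; have [l0 _] := Hl p.
  exists ((2 * T + 1 + (BD p).1) / l p) => N'.
  by rewrite ler_pdivrMr.
pose N0 := (Num.truncn `|N|).+1.
have push p n z : (N0 <= n)%N -> ~ ahead (c (inv_letter p)) T z ->
    ahead (c p) (T + (BD p).1) ((letter g h p ^+ n)%g z).
  move=> Nn; rewrite cinv /ahead/= step_rev => /negP;
    rewrite -ltNge oppr_gt0 => zT.
  have [l0 gl] := Hl p.
  have Nn' : N <= n%:R.
    apply: le_trans (ler_norm _) _; apply: le_trans (ltW (truncnS_gt _)) _.
    by rewrite ler_nat.
  apply: (ahead_le catX (lc p) (t := (- T - 1) + n%:R * l p)).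
    by have := HN _ Nn' p; lra.
  rewrite /ahead/= /step.
  have -> : - T - 1 + n%:R * l p + 1 = (- T - 1 + 1) + n%:R * l p by ring.
  by rewrite !(axis_pow _ _ _ gl); exact: ltW zT.
exists (fun p => ahead (c p) T), (\sum_p (2 * (BD p).2 + 2 * mdist o (c p T))),
  N0; split => //.
- move=> p n z Nn /push => /(_ n Nn); apply: ahead_le => //.
  by have [b0 _ _] := HBD p; lra.
- move=> p n x z Nn xp zp.
  have [b0 d0 cc] := HBD p.
  apply: le_trans (contracting_mdist cc xp (push _ _ _ Nn zp)).
  rewrite lerD2l lerN2 (bigD1 p)//= lerDl; apply: sumr_ge0 => q _.
  by have [_ d0' _] := HBD q; have := mdist_ge0 o (c q T); lra.
Qed.

End PingPong.

(** * Generic products and words *)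

(** Three of the four letters at most are excluded. *)
Lemma letter_outside (A B C : bool * bool -> Prop) :
  (forall p q, A p -> A q -> p = q) -> (forall p q, B p -> B q -> p = q) ->
  (forall p q, C p -> C q -> p = q) -> exists p, [/\ ~ A p, ~ B p & ~ C p].
Proof.
have H (D : bool * bool -> Prop) : (forall p q, D p -> D q -> p = q) ->
    exists d, forall p, D p -> p = d.
  move=> HD; have [[d Dd]|nD] := pselect (exists d, D d);
    first by exists d => p Dp; exact: HD.
  by exists (true, true) => p Dp; case: nD; exists p.
move=> /H[a Ha] /H[b Hb] /H[c Hc]; apply: contrapT => nE.
have sub : {subset enum {: bool * bool} <= [:: a; b; c]}.
  move=> p _; apply: contrapT => /negP;
    rewrite !inE !negb_or => /and3P[pa pb pc].
  apply: nE; exists p; split.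
  - by move=> /Ha E; rewrite E eqxx in pa.
  - by move=> /Hb E; rewrite E eqxx in pb.
  - by move=> /Hc E; rewrite E eqxx in pc.
by have := uniq_leq_size (enum_uniq {: bool * bool}) sub;
  rewrite -cardE card_prod card_bool.
Qed.

Section GenericProduct.
Context {R : realType} (X1 X2 : metricType R) (o : X1 * X2).
Local Notation GT := (isom X1 * isom X2)%type.

Definition disp1 (a : GT) : R := mdist o.1 (a.1 o.1).
Definition disp2 (a : GT) : R := mdist o.2 (a.2 o.2).

Lemma isom_mdistV (X : metricType R) (f : isom X) x y :
  mdist ((f^-1)%g x) y = mdist x (f y).
Proof.
rewrite -(isomP f).1 -[f ((f^-1)%g x)]/(f (isom_inv_fun f x)).
by rewrite isom_inv_funK.
Qed.

Lemma disp_mul (X : metricType R) (x : X) (f k : isom X) :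
  mdist x ((f * k)%g x) <= mdist x (f x) + mdist x (k x).
Proof.
by have := metric_triangle x (f x) (f (k x)); rewrite (isomP f).1.
Qed.

Lemma disp_point (X : metricType R) (x y : X) (f : isom X) :
  `|mdist x (f y) - mdist x y| <= mdist x (f x).
Proof.
have := metric_triangle (f x) x (f y); have := metric_triangle x (f x) (f y).
rewrite (isomP f).1 (metric_sym (f x) x) ler_norml => ? ?.
apply/andP; split; lra.
Qed.

Lemma expg_fst (a : GT) n : ((a ^+ n)%g).1 = (a.1 ^+ n)%g.
Proof. by elim: n => // n IH; rewrite !expgS -IH. Qed.

Lemma expg_snd (a : GT) n : ((a ^+ n)%g).2 = (a.2 ^+ n)%g.
Proof. by elim: n => // n IH; rewrite !expgS -IH. Qed.

Lemma letter_fst (g h : GT) p : (letter g h p).1 = letter g.1 h.1 p.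
Proof. by case: p => [[] []]. Qed.

Lemma letter_snd (g h : GT) p : (letter g h p).2 = letter g.2 h.2 p.
Proof. by case: p => [[] []]. Qed.

Variables (G : groupClosed GT) (g h : GT).
Hypotheses (gG : g \in G) (hG : h \in G).
Variables (U1 : bool * bool -> set X1) (U2 : bool * bool -> set X2).
Variables (k1 k2 : R) (N : nat).
Hypothesis pp1 : ping_pong o.1 (letter g.1 h.1) U1 k1 N.
Hypothesis pp2 : ping_pong o.2 (letter g.2 h.2) U2 k2 N.

Let a p : GT := (letter g h p ^+ N)%g.
Let lam (pq : (bool * bool) * (bool * bool)) : GT := (a pq.1 * a pq.2)%g.

Lemma letter_in p : letter g h p \in G.
Proof. by case: p => [[] []] //=; rewrite /letter/= gpredV. Qed.

(** The power of [b q] moves [e x0] into [U q], away from the repelling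
    neighbourhood of [b p], whose power then moves it deep into [U p], away from
    [f^-1 x0].  Thus the Gromov product that measures the defect of additivity
    is bounded. *)
Lemma generic_point (X : metricType R) (x0 : X) (b : bool * bool -> isom X)
    U k p q (f e : isom X) :
  ping_pong x0 b U k N ->
  ~ U p ((f^-1)%g x0) -> ~ U (inv_letter q) (e x0) -> q <> inv_letter p ->
  `|mdist x0 (f ((b p ^+ N)%g ((b q ^+ N)%g (e x0)))) - mdist x0 (f x0)
      - mdist x0 (e x0)| <=
    `|k| + mdist x0 ((b p ^+ N)%g x0) + mdist x0 ((b q ^+ N)%g x0).
Proof.
move=> [dis _ push dst] xp yq qp; set w := (b q ^+ N)%g (e x0).
have wq : U q w by exact: push.
have wp : ~ U (inv_letter p) w by move=> /(dis _ _ _ wq).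
have := dst p N _ w (leqnn N) xp wp; rewrite !isom_mdistV.
have := disp_point x0 w (b p ^+ N)%g; have := disp_point x0 (e x0) (b q ^+ N)%g.
have := disp_point x0 ((b p ^+ N)%g w) f; have := ler_norm k; rewrite -/w.
rewrite !ler_norml => ? /andP[? ?] /andP[? ?] /andP[? ?] ?.
apply/andP; split; lra.
Qed.

(** In each factor a given point excludes at most one letter. So at least two
    of the four letters p remain that suit both factors on the left; on the
    right each factor excludes at most one letter q and the condition on the
    pair excludes one more. *)
Lemma generic_product : exists kap : R, forall b c : GT, exists i,
  `|disp1 (b * lam i * c)%g - disp1 b - disp1 c| <= kap /\
  `|disp2 (b * lam i * c)%g - disp2 b - disp2 c| <= kap.
Proof.
pose S := \sum_p (disp1 (a p) + disp2 (a p)).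
have d10 b : 0 <= disp1 b := mdist_ge0 _ _.
have d20 b : 0 <= disp2 b := mdist_ge0 _ _.
have S0 p : disp1 (a p) + disp2 (a p) <= S.
  by rewrite /S (bigD1 p)//= lerDl; apply: sumr_ge0 => q _; rewrite addr_ge0.
exists (`|k1| + `|k2| + 2 * S) => b c.
have [dis1 _ _ _] := pp1; have [dis2 _ _ _] := pp2.
have [p [p1 p2 _]] :=
  @letter_outside (U1^~ ((b.1^-1)%g o.1)) (U2^~ ((b.2^-1)%g o.2)) (fun=> False)
  (fun p q => @dis1 p q _) (fun p q => @dis2 p q _)
  (fun p q f _ => False_ind _ f).
have invI (V : Type) (U : bool * bool -> set V) y :
    (forall p q z, U p z -> U q z -> p = q) ->
    forall p q, U (inv_letter p) y -> U (inv_letter q) y -> p = q.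
  by move=> dis p' q' h1 h2; apply: (inv_inj inv_letterK); exact: dis h1 h2.
have [q [q1 q2 qp]] := @letter_outside (fun q => U1 (inv_letter q) (c.1 o.1))
  (fun q => U2 (inv_letter q) (c.2 o.2)) (fun q => q = inv_letter p)
  (invI _ _ _ dis1) (invI _ _ _ dis2) (fun q q' E E' => etrans E (esym E')).
have h1 := generic_point pp1 p1 q1 qp; have h2 := generic_point pp2 p2 q2 qp.
rewrite -!letter_fst -!expg_fst in h1; rewrite -!letter_snd -!expg_snd in h2.
have Sp := S0 p; have Sq := S0 q.
have := d10 (a p); have := d10 (a q); have := d20 (a p); have := d20 (a q).
have := normr_ge0 k1; have := normr_ge0 k2.
exists (p, q); split; [apply: le_trans h1 _ | apply: le_trans h2 _];
  rewrite -/(a p) -/(a q) -/(disp1 (a p)) -/(disp1 (a q)) -/(disp2 (a p))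
    -/(disp2 (a q)); lra.
Qed.

Lemma lam_in i : lam i \in G.
Proof. by apply: gpredM; apply: gpredXn; exact: letter_in. Qed.

Fixpoint word (w : seq bool) : GT :=
  if w is b :: w' then (a (b, true) * word w')%g else 1%g.

Lemma word_in w : word w \in G.
Proof.
elim: w => [|b w IH]; first exact: gpred1.
by apply: gpredM => //; apply: gpredXn; exact: letter_in.
Qed.

Lemma word_head b w : U1 (b, true) ((word (b :: w)).1 o.1).
Proof.
have [dis oU push _] := pp1.
elim: w b => [|b' w IH] b.
  by rewrite -[X in U1 _ X]/((a (b, true)).1 o.1) expg_fst letter_fst;
    apply: push => //; exact: oU.
rewrite -[X in U1 _ X]/((a (b, true)).1 ((word (b' :: w)).1 o.1)).
rewrite expg_fst letter_fst.
by apply: push => // /(dis _ _ _ (IH b')).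
Qed.

(** Words with different first letters move the base point of the first factor
    into disjoint sets. *)
Lemma word_inj w w' : size w = size w' -> word w = word w' -> w = w'.
Proof.
have [dis _ _ _] := pp1.
elim: w w' => [|b w IH] [|b' w'] //= [sw] E.
have bb : b = b'.
  have := word_head b w; rewrite [word _]/= E => h1.
  by have [] := dis _ _ _ h1 (word_head b' w').
by rewrite bb in E *; rewrite (IH w' sw (mulgI _ _ _ E)).
Qed.

Lemma word_disp : exists2 C : R, 0 <= C & forall w,
  disp1 (word w) <= C * (size w)%:R /\ disp2 (word w) <= C * (size w)%:R.
Proof.
pose C := \sum_p (disp1 (a p) + disp2 (a p)).
have d10 b : 0 <= disp1 b := mdist_ge0 _ _.
have d20 b : 0 <= disp2 b := mdist_ge0 _ _.
have C0 p : disp1 (a p) + disp2 (a p) <= C.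
  by rewrite /C (bigD1 p)//= lerDl; apply: sumr_ge0 => q _; rewrite addr_ge0.
exists C; first by apply: sumr_ge0 => q _; rewrite addr_ge0.
elim=> [|b w [IH1 IH2]]; first by rewrite mulr0 /disp1 /disp2 !mdistxx.
have h1 := disp_mul o.1 (a (b, true)).1 (word w).1;
  have h2 := disp_mul o.2 (a (b, true)).2 (word w).2.
have Cb := C0 (b, true); have c1 := d10 (a (b, true));
  have c2 := d20 (a (b, true)).
rewrite [size _]/= -natr1 mulrDr mulr1; split.
  by apply: le_trans h1 _; rewrite addrC lerD//; rewrite /disp1 in Cb *; lra.
by apply: le_trans h2 _; rewrite addrC lerD//; rewrite /disp2 in Cb *; lra.
Qed.

End GenericProduct.

(** * Growth rates *)

Section ExtendedReals.
Context {R : realType}.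

Lemma limn_esup_ge (u : nat -> \bar R) (x : \bar R) :
  (forall N, exists2 n, (N <= n)%N & (x <= u n)%E) -> (x <= limn_esup u)%E.
Proof.
move=> H; rewrite /limn_esup limf_esupE;
  apply: le_ereal_inf_tmp => _ [V [N _ NV] <-].
have [n Nn xn] := H N; apply: le_trans xn _; apply: ereal_sup_ubound.
by exists n => //; exact: NV.
Qed.

Lemma limn_esup_Ny (u : nat -> \bar R) N :
  (forall n, (N <= n)%N -> u n = -oo%E) -> limn_esup u = -oo%E.
Proof.
move=> H; apply/eqP; rewrite -leeNy_eq /limn_esup limf_esupE.
apply: (@le_trans _ _ (ereal_sup [set u x | x in [set n | (N <= n)%N]])).
  apply: ereal_inf_lbound; exists [set n | (N <= n)%N] => //;
    exact: nbhs_infty_ge.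
by apply: ge_ereal_sup => _ [n /= Nn <-]; rewrite H.
Qed.

Lemma limf_einf_right_ge (f : R -> \bar R) (x : \bar R) :
  (forall e : R, 0 < e -> (x <= f e)%E) -> (x <= limf_einf f (0 : R)^'+)%E.
Proof.
move=> H; rewrite limf_einfE; apply: le_ereal_sup_tmp.
exists (ereal_inf (f @` [set e | 0 < e])); last first.
  by apply: le_ereal_inf_tmp => _ [e /= e0 <-]; exact: H.
by exists [set e | 0 < e] => //; exact: nbhs_right_gt.
Qed.

Lemma limf_einf_right_Ny (f : R -> \bar R) (e0 : R) : 0 < e0 ->
  (forall e : R, 0 < e -> e <= e0 -> f e = -oo%E) ->
  limf_einf f (0 : R)^'+ = -oo%E.
Proof.
move=> e00 H; apply/eqP; rewrite -leeNy_eq limf_einfE.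
apply: ge_ereal_sup => _ [V V0 <-].
have [e [Ve [e1 e2]]] : exists e, V e /\ (0 < e /\ e <= e0).
  near (0 : R)^'+ => e; exists e; split; first by near: e.
  by split; near: e; [exact: nbhs_right_gt | exact: nbhs_right_le].
rewrite -(H e e1 e2); apply: ereal_inf_lbound; by exists e.
Unshelve. all: by end_near. Qed.

End ExtendedReals.

Lemma counting_set0 (T : choiceType) (R : realType) :
  counting (set0 : set T) = 0%E :> \bar R.
Proof. by rewrite /counting asboolT// fset_set0. Qed.

Lemma counting_ge_size (T : choiceType) (R : realType) (A : set T) (s : seq T) :
  uniq s -> {in s, forall x, A x} -> ((size s)%:R%:E <= counting A :> \bar R)%E.
Proof.
move=> us sA; rewrite /counting; case: asboolP => [fA|_]; last exact: leey.
rewrite lee_fin ler_nat; apply: uniq_leq_size => // x /sA Ax.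
by rewrite in_fset_set// inE.
Qed.

Section Annulus.
Context {R : realType} (X1 X2 : metricType R) (o : X1 * X2).
Local Notation GT := (isom X1 * isom X2)%type.
Variable (G : groupClosed GT).

(** The logarithm of the cardinality of an empty annulus is -oo. *)
Lemma annulus_nonempty (theta eps : R) N : 0 < eps ->
  (0 <= growth_rate G o theta)%E ->
  exists2 n, (N <= n)%N & slope_annulus G o eps theta n !=set0.
Proof.
move=> e0 g0; apply: contrapT => H.
suff E : growth_rate G o theta = -oo%E by rewrite E in g0.
apply: (limf_einf_right_Ny e0) => e e1 e2.
apply: (@limn_esup_Ny _ _ N.+1) => n Nn.
have -> : slope_annulus G o e theta n = set0.
  apply/seteqP; split=> [a [aG ao an ae]|//]; exfalso; apply: H; exists n;
    first exact: ltnW.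
  by exists a; split => //; exact: le_trans e2.
rewrite counting_set0 le0_lneNy// gt0_mulNye// lte_fin invr_gt0 ltr0n.
exact: leq_ltn_trans Nn.
Qed.

Lemma prod_distE (a : GT) :
  prod_dist o (prod_act a o) = Num.sqrt (disp1 o a ^+ 2 + disp2 o a ^+ 2).
Proof. by []. Qed.

Lemma prod_dist_le (a : GT) :
  prod_dist o (prod_act a o) <= disp1 o a + disp2 o a.
Proof.
have h1 : 0 <= disp1 o a := mdist_ge0 _ _;
  have h2 : 0 <= disp2 o a := mdist_ge0 _ _.
rewrite prod_distE -(@ler_sqr _ (Num.sqrt _)) ?nnegrE ?sqrtr_ge0 ?addr_ge0//.
rewrite sqr_sqrtr ?addr_ge0 ?sqr_ge0//.
have : 0 <= disp1 o a * disp2 o a by exact: mulr_ge0.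
lra.
Qed.

Lemma disp1_le (a : GT) : disp1 o a <= prod_dist o (prod_act a o).
Proof.
have h1 : 0 <= disp1 o a := mdist_ge0 _ _.
rewrite prod_distE -(@ler_sqr _ (disp1 o a)) ?nnegrE ?sqrtr_ge0//.
by rewrite sqr_sqrtr ?addr_ge0 ?sqr_ge0// lerDl sqr_ge0.
Qed.

Lemma element_near_slope_0 (s L : R) : 0 < s -> s <= 1 ->
  (0 <= growth_rate G o 0)%E ->
  exists a, [/\ a \in G, L <= disp1 o a & disp2 o a <= s * disp1 o a].
Proof.
move=> s0 s1 g0.
have s0' : 0 < atan s by rewrite -(atan0 R); exact: lt_atan.
have [n Nn [a [aG _ /andP[an _] asl]]] :=
  annulus_nonempty (Num.truncn (2 * `|L|)).+2 s0' g0.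
have h1 : 0 <= disp1 o a := mdist_ge0 _ _;
  have h2 : 0 <= disp2 o a := mdist_ge0 _ _.
have sl : disp2 o a <= s * disp1 o a.
  move: asl; rewrite subr0 /slope -/(disp1 o a) -/(disp2 o a).
  have [E|E] := eqVneq (disp1 o a) 0.
    rewrite ger0_norm; last by rewrite divr_ge0// pi_ge0.
    by move=> /(lt_le_trans (atan_ltpi2 s)); rewrite ltxx.
  have p1 : 0 < disp1 o a by rewrite lt_neqAle eq_sym E.
  move=> /(le_trans (ler_norm _)); rewrite (le_mono (@lt_atan R)).
  by rewrite ler_pdivrMr.
exists a; split => //.
have := prod_dist_le a;
  have : s * disp1 o a <= 1 * disp1 o a by exact: ler_wpM2r.
have : (Num.truncn (2 * `|L|)).+2%:R <= n%:R :> R by rewrite ler_nat.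
have := truncnS_gt (2 * `|L|); rewrite -[_.+2%:R]natr1; have := ler_norm L; lra.
Qed.

Lemma element_near_slope_pi2 (s L : R) : 0 < s -> s <= 1 ->
  (0 <= growth_rate G o (pi / 2))%E ->
  exists a, [/\ a \in G, L <= disp2 o a & disp1 o a <= s * disp2 o a].
Proof.
move=> s0 s1 g0.
have s0' : 0 < pi / 2 - atan s^-1 by rewrite subr_gt0 atan_ltpi2.
have [n Nn [a [aG _ /andP[an _] asl]]] :=
  annulus_nonempty (Num.truncn (2 * `|L|)).+2 s0' g0.
have h1 : 0 <= disp1 o a := mdist_ge0 _ _;
  have h2 : 0 <= disp2 o a := mdist_ge0 _ _.
have sl : disp1 o a <= s * disp2 o a.
  move: asl; rewrite /slope -/(disp1 o a) -/(disp2 o a).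
  have [E|E] := eqVneq (disp1 o a) 0.
    by move=> _; rewrite E mulr_ge0// ltW.
  have p1 : 0 < disp1 o a by rewrite lt_neqAle eq_sym E.
  rewrite distrC => /(le_trans (ler_norm _));
    rewrite lerD2l lerN2 (le_mono (@lt_atan R)).
  by rewrite ler_pdivlMr// mulrC ler_pdivrMr// mulrC.
exists a; split => //.
have := prod_dist_le a;
  have : s * disp2 o a <= 1 * disp2 o a by exact: ler_wpM2r.
have : (Num.truncn (2 * `|L|)).+2%:R <= n%:R :> R by rewrite ler_nat.
have := truncnS_gt (2 * `|L|); rewrite -[_.+2%:R]natr1; have := ler_norm L; lra.
Qed.

End Annulus.

(** * Completion of words and counting *)

Lemma large_fiber (S U : finType) (f : S -> U) (u0 : U) :
  exists u, (#|S| <= #|U| * #|[pred s | f s == u]|)%N.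
Proof.
pose F u := #|[pred s | f s == u]|.
exists [arg max_(u > u0) F u]; case: arg_maxnP => // u _ Hu.
rewrite -sum1_card (partition_big f predT)//= -sum_nat_const.
apply: leq_sum => v _; apply: leq_trans (Hu v isT).
by rewrite sum1_card.
Qed.

Section Counting.
Context {R : realType}.

(** Here (W1, W2) is the displacement of a word, (A1, A2) and (B1, B2) are
    those of two elements of G of displacement at least L whose slopes are
    close to 0 and pi/2 up to s, and k bounds the error of a generic product.
    Rounding down (M - W1) / A1 and (M T - W2) / B2 costs A1 and B2, the
    skewness of the two elements costs at most s M (1 + T), and the errors of
    at most M (1 + T) / L + 1 generic products add up to k times this number:
    all this is small relative to M. *)
Lemma correction (T r k A1 A2 B1 B2 s L M W1 W2 : R) :
  0 < T -> 0 < r -> 0 <= k -> 1 <= L -> L <= A1 -> L <= B2 ->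
  0 <= A2 -> A2 <= s * A1 -> 0 <= B1 -> B1 <= s * B2 -> 0 <= s ->
  s * (1 + T) <= r / 4 -> k * (1 + T) <= r / 4 * L ->
  A1 + B2 + k <= r / 2 * M ->
  0 <= W1 -> W1 <= M -> 0 <= W2 -> W2 <= M * T ->
  exists p q : nat, [/\ p%:R <= M, q%:R <= M * T & forall v1 v2,
    `|v1 - (W1 + (p%:R * A1 + q%:R * B1))| <= (p%:R + q%:R + 1) * k ->
    `|v2 - (W2 + (p%:R * A2 + q%:R * B2))| <= (p%:R + q%:R + 1) * k ->
    `|v1 - M| <= r * M /\ `|v2 - M * T| <= r * M].
Proof.
move=> T0 r0 k0 L1 LA LB A20 A2s B10 B1s s0 sT kT big W10 W1M W20 W2M.
have A0 : 0 < A1 by lra.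
have B0 : 0 < B2 by lra.
have M0 : 0 <= M by lra.
have div (x y : R) : 0 < x -> 0 <= y ->
    exists p : nat, p%:R * x <= y /\ y <= p%:R * x + x.
  move=> x0 y0; exists (Num.truncn (y / x)).
  have yx : 0 <= y / x by rewrite divr_ge0// ltW.
  rewrite -ler_pdivlMr// truncn_le//; split => //.
  have := truncnS_gt (y / x); rewrite ltr_pdivrMr// -natr1 mulrDl mul1r;
    exact: ltW.
have [p [p1 p2]] := div A1 (M - W1) A0 ltac:(lra).
have [q [q1 q2]] := div B2 (M * T - W2) B0 ltac:(lra).
exists p, q; have p0 : 0 <= p%:R :> R by []. have q0 : 0 <= q%:R :> R by [].
move: (p%:R : R) (q%:R : R) p0 q0 p1 p2 q1 q2 => P Q P0 Q0 P1 P2 Q1 Q2.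
have PL : P * L <= P * A1 by exact: ler_wpM2l.
have QL : Q * L <= Q * B2 by exact: ler_wpM2l.
have PL1 : P * 1 <= P * L by exact: ler_wpM2l.
have QL1 : Q * 1 <= Q * L by exact: ler_wpM2l.
split; [lra|lra|] => v1 v2 h1 h2.
have T1 : 0 < 1 + T by lra.
have PQ0 : 0 <= P + Q by lra.
have PQk : (P + Q) * k <= r / 4 * M.
  rewrite -(ler_pM2r T1).
  have := ler_wpM2l PQ0 kT.
  have r4 : 0 <= r / 4 by lra.
  have := ler_wpM2l r4 (_ : (P + Q) * L <= M * (1 + T)) => /(_ ltac:(lra)).
  lra.
have qb : Q * B1 <= r / 4 * M.
  have := ler_wpM2l Q0 B1s.
  have : s * (Q * B2) <= s * (M * T) by apply: ler_wpM2l => //; lra.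
  have := ler_wpM2r M0 sT.
  have : 0 <= s * M by apply: mulr_ge0.
  lra.
have pa : P * A2 <= r / 4 * M.
  have := ler_wpM2l P0 A2s.
  have : s * (P * A1) <= s * M by apply: ler_wpM2l => //; lra.
  have := ler_wpM2r M0 sT.
  have : 0 <= s * M * T by apply: mulr_ge0; [apply: mulr_ge0|lra].
  lra.
have qb0 : 0 <= Q * B1 by exact: mulr_ge0.
have pa0 : 0 <= P * A2 by exact: mulr_ge0.
move: h1 h2; rewrite !ler_norml => /andP[h1 h2] /andP[h3 h4].
by split; apply/andP; split; lra.
Qed.

Lemma cube_le_expR (c : R) : 0 <= c ->
  exists m0 : nat, forall m : nat, (m0 <= m)%N ->
  c * m%:R ^+ 3 <= expR (m%:R * (ln 2 / 2)).
Proof.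
move=> c0; pose a : R := ln 2 / 2.
have a0 : 0 < a by rewrite divr_gt0// ln_gt0// ltr1n.
have a4 : 0 < a ^+ 4 / 24 by rewrite divr_gt0// exprn_gt0.
exists (Num.truncn (c / (a ^+ 4 / 24))).+1 => m mm; rewrite -/a.
have m0 : 0 <= m%:R :> R by [].
have ma0 : 0 <= m%:R * a by rewrite mulr_ge0// ltW.
apply: le_trans (_ : (m%:R * a) ^+ 4 / 4`!%:R <= _); last first.
  by apply: le_trans (expR_ge1Dxn 3 ma0); rewrite lerDr.
have -> : (m%:R * a) ^+ 4 / 4`!%:R = (a ^+ 4 / 24) * m%:R * m%:R ^+ 3.
  by rewrite !factS fact0; field.
apply: ler_wpM2r; first exact: exprn_ge0.
rewrite mulrC -ler_pdivrMr//.
apply: le_trans (ltW (truncnS_gt _)) _.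
by rewrite ler_nat.
Qed.

Lemma atan_close (theta eps T : R) : 0 < eps -> 0 < T -> atan T = theta ->
  exists2 r : R, 0 < r & r <= 1 / 2 /\ forall M v1 v2 : R, 0 < M ->
    `|v1 - M| <= r * M -> `|v2 - M * T| <= r * M ->
    0 < v1 /\ `|atan (v2 / v1) - theta| <= eps.
Proof.
move=> e0 T0 <-.
have /cvgrPdist_le /(_ eps e0) := @continuous_atan R T.
case/nbhs_ballP => d /= d0 Hd.
pose r := Num.min (1 / 2) (d / (4 * (1 + T))).
have r0 : 0 < r by rewrite lt_min divr_gt0//= divr_gt0// mulr_gt0// addr_gt0.
have r1 : r <= 1 / 2 by rewrite ge_min lexx.
have r2 : r * (4 * (1 + T)) <= d.
  rewrite -ler_pdivlMr; last by rewrite mulr_gt0// addr_gt0.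
  by rewrite ge_min lexx orbT.
exists r => //; split => // M v1 v2 M0 h1 h2.
have rM : r * M <= 1 / 2 * M by rewrite ler_wpM2r// ltW.
have := h1; have := h2; rewrite ![`|_| <= r * M]ler_norml.
move=> /andP[h5 h6] /andP[h3 h4].
have v10 : M / 2 <= v1 by lra.
have v1p : 0 < v1 by lra.
split => //; rewrite distrC; apply: Hd; rewrite /ball/=.
have rMT : 0 <= r * M * T by rewrite !mulr_ge0// ltW.
have E : T - v2 / v1 = (T * v1 - v2) / v1 by field; lra.
rewrite E normrM normfV (gtr0_norm v1p) ltr_pdivrMr//.
apply: (@le_lt_trans _ _ (r * M * (1 + T))).
  by rewrite ler_norml; apply/andP; split; nra.
have q : r * (4 * (1 + T)) * M <= d * M by rewrite ler_wpM2r// ltW.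
have q2 : d * (M / 2) <= d * v1 by rewrite ler_wpM2l// ltW.
have : 0 < d * M by rewrite mulr_gt0.
lra.
Qed.

End Counting.

Section Growth.
Context {R : realType} (X1 X2 : metricType R) (o : X1 * X2).
Local Notation GT := (isom X1 * isom X2)%type.
Variables (G : groupClosed GT) (I : finType) (lam : I -> GT) (kap C : R).
Variable word : seq bool -> GT.
Local Notation d1 := (disp1 o).
Local Notation d2 := (disp2 o).
Hypothesis lamG : forall i, lam i \in G.
Hypothesis generic : forall b c : GT, exists i,
  `|d1 (b * lam i * c)%g - d1 b - d1 c| <= kap /\
    `|d2 (b * lam i * c)%g - d2 b - d2 c| <= kap.
Hypothesis wordG : forall w, word w \in G.
Hypothesis word_inj : forall w w', size w = size w' -> word w = word w' ->
  w = w'.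
Hypothesis C0 : 0 <= C.
Hypothesis word_le : forall w,
  d1 (word w) <= C * (size w)%:R /\ d2 (word w) <= C * (size w)%:R.

Lemma kap_ge0 : 0 <= kap.
Proof. by have [i [h _]] := generic 1%g 1%g; apply: le_trans h. Qed.

Lemma generic_powers (a b : GT) (p q : nat) : a \in G -> b \in G ->
  exists t, [/\ t \in G,
  `|d1 t - (p%:R * d1 a + q%:R * d1 b)| <= (p%:R + q%:R) * kap &
  `|d2 t - (p%:R * d2 a + q%:R * d2 b)| <= (p%:R + q%:R) * kap].
Proof.
move=> aG bG.
have d10 : d1 1%g = 0 by rewrite /disp1 mdistxx.
have d20 : d2 1%g = 0 by rewrite /disp2 mdistxx.
have step (e t : GT) : exists i, [/\ d1 e + d1 t - kap <= d1 (e * lam i * t)%g,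
   d1 (e * lam i * t)%g <= d1 e + d1 t + kap,
   d2 e + d2 t - kap <= d2 (e * lam i * t)%g &
   d2 (e * lam i * t)%g <= d2 e + d2 t + kap].
  have [i []] := generic e t; rewrite !ler_norml => /andP[? ?] /andP[? ?].
  by exists i; split; lra.
elim: p => [|p [t [tG]]].
  elim: q => [|q [t [tG]]].
    by exists 1%g; split;
      rewrite ?gpred1// ?d10 ?d20 !mul0r !addr0 ?subrr normr0 mul0r.
  rewrite !ler_norml => /andP[h1 h2] /andP[h3 h4].
  have [i [k1 k2 k3 k4]] := step b t.
  exists (b * lam i * t)%g; split; first by rewrite !gpredM.
    by rewrite -[q.+1%:R]natr1 ler_norml; apply/andP; split; lra.
  by rewrite -[q.+1%:R]natr1 ler_norml; apply/andP; split; lra.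
rewrite !ler_norml => /andP[h1 h2] /andP[h3 h4].
have [i [k1 k2 k3 k4]] := step a t.
exists (a * lam i * t)%g; split; first by rewrite !gpredM.
  by rewrite -[p.+1%:R]natr1 ler_norml; apply/andP; split; lra.
by rewrite -[p.+1%:R]natr1 ler_norml; apply/andP; split; lra.
Qed.

Variables (theta T : R).
Hypotheses (T0 : 0 < T) (atanT : atan T = theta).
Hypothesis growth0 : (0 <= growth_rate G o 0)%E.
Hypothesis growth1 : (0 <= growth_rate G o (pi / 2))%E.

(** C <= K and C <= K T, so that the displacement of a word of length m does not
    exceed K m (1, T) in either coordinate. *)
Let K := C + C / T + 1.
Let c1 := (T + 2) * K + 2.

(** Each word of length m is completed to an element of slope close to theta,
    in an annulus of index between K m / 2 and c1 m. The completion is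
    determined by its numbers p, q of powers and by one element of the family
    [lam]; together with the index of the annulus, these take at most #|I| (c1
    m)^3 values. *)
Lemma many_elements (eps : R) : 0 < eps -> exists m0 : nat, forall m : nat,
  (m0 <= m)%N ->
  exists n : nat, [/\ K * m%:R / 2 <= n%:R, n%:R <= c1 * m%:R &
    (((2 ^ m)%:R / (#|I|%:R * (c1 * m%:R) ^+ 3))%:E <=
      counting (slope_annulus G o eps theta n))%E].
Proof.
move=> e0; have [r r0 [r1 close]] := atan_close e0 T0 atanT.
have k0 := kap_ge0; have T1 : 0 < 1 + T by rewrite addr_gt0.
pose s := Num.min 1 (r / 4 / (1 + T)).
have s0 : 0 < s by rewrite lt_min ltr01 divr_gt0// divr_gt0.
have s1 : s <= 1 by rewrite ge_min lexx.
have sT : s * (1 + T) <= r / 4 by rewrite -ler_pdivlMr// ge_min lexx orbT.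
pose L := 1 + kap * (1 + T) / (r / 4).
have r4 : 0 < r / 4 by rewrite divr_gt0.
have kT0 : 0 <= kap * (1 + T) by rewrite mulr_ge0// ltW.
have L1 : 1 <= L by rewrite lerDl divr_ge0// ltW.
have kL : kap * (1 + T) <= r / 4 * L.
  have E : r / 4 * (kap * (1 + T) / (r / 4)) = kap * (1 + T).
    by rewrite mulrC divfK ?gt_eqF.
  by rewrite /L [leRHS]mulrDr mulr1 E lerDr ltW.
have [a [aG aL asl]] := element_near_slope_0 L s0 s1 growth0.
have [b [bG bL bsl]] := element_near_slope_pi2 L s0 s1 growth1.
have [tau Htau] := choice (fun pq : nat * nat =>
  generic_powers pq.1 pq.2 aG bG).
have K0 : 0 < K by rewrite ltr_wpDl// addr_ge0// divr_ge0// ltW.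
have CK : C <= K by rewrite /K -addrA lerDl addr_ge0// divr_ge0// ltW.
have CKT : C <= K * T.
  rewrite /K !mulrDl divfK ?gt_eqF// mul1r.
  have : 0 <= C * T by rewrite mulr_ge0// ltW.
  have := ltW T0; lra.
pose E := d1 a + d2 b + kap.
exists (Num.truncn (E / (r / 2 * K))).+1 => m mm.
have m1 : 1 <= m%:R :> R by rewrite ler1n (leq_trans _ mm).
pose M := K * m%:R.
have big : E <= r / 2 * M.
  rewrite /M mulrA mulrC -ler_pdivrMr; last by rewrite mulr_gt0// divr_gt0.
  by apply: le_trans (ltW (truncnS_gt _)) _; rewrite ler_nat.
have KM : K * 1 <= M by rewrite ler_wpM2l// ltW.
have M0 : 0 < M by lra.
pose Z := Num.truncn ((T + 2) * M + 1).
have ZE : Z%:R <= (T + 2) * M + 1.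
  by rewrite truncn_le// addr_ge0// mulr_ge0//;
    [rewrite addr_ge0// ltW | exact: ltW].
have TM : 0 <= T * M by rewrite mulr_ge0// ltW.
have leZ (n : nat) : n%:R <= (T + 2) * M + 1 -> (n < Z.+1)%N.
  by move=> nZ; rewrite ltnS truncn_ge_nat//; apply: le_trans nZ.
have elt (w : m.-tuple bool) :
    exists pqin : ('I_Z.+1 * 'I_Z.+1) * (I * 'I_Z.+1),
    let t := (word w * lam pqin.2.1 * tau (pqin.1.1 : nat, pqin.1.2 : nat))%g in
    slope_annulus G o eps theta pqin.2.2 t /\ M / 2 <= pqin.2.2%:R.
  have [w1 w2] := word_le w; rewrite size_tuple in w1 w2.
  have W1 : d1 (word w) <= M by apply: le_trans w1 _; rewrite ler_wpM2r.
  have W2 : d2 (word w) <= M * T.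
    by apply: le_trans w2 _; rewrite /M mulrAC ler_wpM2r.
  have g0 x : 0 <= d1 x /\ 0 <= d2 x by split; exact: mdist_ge0.
  have [p [q [pM qM Hpq]]] :=
    correction T0 r0 k0 L1 aL bL (g0 a).2 asl (g0 b).1 bsl
     (ltW s0) sT kL big (g0 (word w)).1 W1 (g0 (word w)).2 W2.
  have [i [i1 i2]] := generic (word w) (tau (p, q)).
  have [tG t1 t2] := Htau (p, q).
  set t := (word w * lam i * tau (p, q))%g in i1 i2.
  have [h1 h2] : `|d1 t - M| <= r * M /\ `|d2 t - M * T| <= r * M.
    move: i1 i2 t1 t2 => /=;
      rewrite !ler_norml => /andP[i1 i2] /andP[i3 i4] /andP[j1 j2] /andP[j3 j4].
    have := Hpq (d1 t) (d2 t).
    by rewrite !ler_norml; apply; apply/andP; split; lra.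
  have [t0 tsl] := close _ _ _ M0 h1 h2.
  pose n := (Num.truncn (prod_dist o (prod_act t o))).+1.
  have td := disp1_le o t; have td' := prod_dist_le o t.
  have rM : r * M <= 1 / 2 * M by rewrite ler_wpM2r// ltW.
  have pd0 : 0 < prod_dist o (prod_act t o) by exact: lt_le_trans td.
  have n1 : prod_dist o (prod_act t o) < n%:R by exact: truncnS_gt.
  have n2 : n%:R - 1 <= prod_dist o (prod_act t o).
    by rewrite -natr1 addrK truncn_le// ltW.
  move: h1 h2; rewrite !ler_norml => /andP[h1 h2] /andP[h3 h4].
  have pZ : (p < Z.+1)%N by apply: leZ; lra.
  have qZ : (q < Z.+1)%N by apply: leZ; lra.
  have nZ : (n < Z.+1)%N by apply: leZ; lra.
  exists ((Ordinal pZ, Ordinal qZ), (i, Ordinal nZ)) => /=; rewrite -/t.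
  split; last lra.
  split; first by exact: (gpredM _ _ (gpredM _ _ (wordG w) (lamG i)) tG).
  - by move=> E0; move: pd0;
      rewrite E0 /prod_dist !mdistxx expr0n/= addr0 sqrtr0 ltxx.
  - by rewrite n2 n1.
  - by rewrite /slope gt_eqF.
have [f Hf] := choice elt.
have w0 : m.-tuple bool := [tuple of nseq m true].
have [u Hu] := large_fiber f (f w0).
have S0 : (0 < #|{: m.-tuple bool}|)%N by rewrite card_tuple card_bool expn_gt0.
have /card_gt0P[w1 /eqP fw1] : (0 < #|[pred w | f w == u]|)%N.
  by have := leq_trans S0 Hu; rewrite muln_gt0 => /andP[].
exists (u.2.2 : nat); split.
- by have [_] := Hf w1; rewrite fw1.
- have : (u.2.2 : nat)%:R <= Z%:R :> R by rewrite ler_nat -ltnS.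
  rewrite /c1 -/K; have := KM; rewrite /M in ZE *; lra.
pose g (w : m.-tuple bool) :=
  (word w * lam u.2.1 * tau (u.1.1 : nat, u.1.2 : nat))%g.
have gI : {in enum [pred w | f w == u] &, injective g}.
  move=> w w' _ _ /mulIg /mulIg E'; apply: val_inj; apply: word_inj E'.
  by rewrite !size_tuple.
apply: (@le_trans _ _ (size (map g (enum [pred w | f w == u])))%:R%:E);
  last first.
  apply: counting_ge_size; first by rewrite map_inj_in_uniq// enum_uniq.
  move=> x /mapP[w]; rewrite mem_enum inE => /eqP fw ->.
  by have [h _] := Hf w; rewrite fw in h.
rewrite lee_fin size_map -cardE.
rewrite card_tuple card_bool !card_prod !card_ord in Hu.
have I0 : 0 < #|I|%:R :> R by rewrite ltr0n; apply/card_gt0P; exists u.2.1.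
have cm0 : 0 < c1 * m%:R.
  by rewrite mulr_gt0//;
    [rewrite addr_gt0// mulr_gt0// addr_gt0 | exact: lt_le_trans m1].
have Zc : Z.+1%:R <= c1 * m%:R.
  by rewrite -natr1 /c1 -/K; have := KM; rewrite /M in ZE *; lra.
rewrite ler_pdivrMr; last by rewrite mulr_gt0// exprn_gt0.
apply: (@le_trans _ _
  ((Z.+1 * Z.+1 * (#|I| * Z.+1) * #|[pred w | f w == u]|)%N%:R)).
  by rewrite ler_nat.
rewrite natrM mulrC ler_wpM2l//.
have -> : (Z.+1 * Z.+1 * (#|I| * Z.+1))%N%:R = #|I|%:R * Z.+1%:R ^+ 3 :> R.
  by rewrite !natrM; ring.
by rewrite ler_pM2l//; apply: lerXn2r; rewrite ?nnegrE// ltW.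
Qed.

(** For large m the polynomial denominator in [many_elements] is at most the
    square root of 2^m. *)
Lemma growth_rate_ge : ((ln 2 / (2 * c1))%:E <= growth_rate G o theta)%E.
Proof.
have K0 : 0 < K by rewrite ltr_wpDl// addr_ge0// divr_ge0// ltW.
have c10 : 0 < c1 by rewrite addr_gt0// mulr_gt0// addr_gt0.
apply: limf_einf_right_ge => eps e0; apply: limn_esup_ge => N.
have [m1 H1] := many_elements e0.
have [m2 H2] := @cube_le_expR R (#|I|%:R * c1 ^+ 3)
  ltac:(by rewrite mulr_ge0// exprn_ge0// ltW).
(* The last summand makes the annulus of index at least [N]. *)
pose m := (m1 + m2 + (Num.truncn (2 * N%:R / K)).+1)%N.
have m0 : (0 < m)%N by rewrite /m addnS.
have m0' : 0 < m%:R :> R by rewrite ltr0n.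
have [n [n1 n2 n3]] := H1 m ltac:(by rewrite /m -addnA leq_addr).
have h2 := H2 m ltac:(by rewrite /m -addnA addnCA leq_addr).
have Km : 2 * N%:R <= K * m%:R.
  rewrite [leRHS]mulrC -ler_pdivrMr//; apply: le_trans (ltW (truncnS_gt _)) _.
  by rewrite ler_nat leq_addl.
exists n; first by rewrite -(ler_nat R); lra.
have n0 : 0 < n%:R :> R by apply: lt_le_trans n1; rewrite divr_gt0// mulr_gt0.
set y := expR _ in h2.
have y0 : 0 < y := expR_gt0 _.
have yn : (y%:E <= counting (slope_annulus G o eps theta n))%E.
  apply: le_trans n3; rewrite lee_fin.
  have I0 : 0 < #|I|%:R * (c1 * m%:R) ^+ 3.
    rewrite mulr_gt0// ?exprn_gt0 ?mulr_gt0// ltr0n.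
    have [i _] := generic 1%g 1%g; apply/card_gt0P; by exists i.
  rewrite ler_pdivlMr//.
  have -> : (2 ^ m)%:R = y * y :> R.
    by rewrite /y -expRD -mulrDr -splitr mulrC expRM_natr lnK ?posrE// natrX.
  by rewrite ler_pM2l// exprMn mulrA.
apply: (@le_trans _ _ ((m%:R * (ln 2 / 2))%:E * (n%:R^-1)%:E)%E).
  rewrite -EFinM lee_fin ler_pdivlMr//.
  apply: (@le_trans _ _ (ln 2 / (2 * c1) * (c1 * m%:R))).
    by rewrite ler_wpM2l// divr_ge0 ?ln_ge0 ?ler1n// mulr_ge0// ltW.
  rewrite le_eqVlt; apply/orP; left; apply/eqP; field; exact: lt0r_neq0.
apply: lee_wpmul2r; first by rewrite lee_fin invr_ge0 ltW.
rewrite -[m%:R * _]expRK -lne_EFin// lee_lne//.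
- by rewrite in_itv/= leey andbT lee_fin ltW.
- by rewrite in_itv/= leey andbT; apply: le_trans yn; rewrite lee_fin ltW.
Qed.

End Growth.

Theorem theorem1p3 (R : realType) (X1 X2 : completeMetricType R)
    (hX1 : proper_hadamard X1) (hX2 : proper_hadamard X2)
    (o : X1 * X2) (G : groupClosed (isom X1 * isom X2)%type)
    (G_proper : acts_properly G)
    (g h : isom X1 * isom X2) (gG : g \in G) (hG : h \in G)
    (gh1 : independent_rank_one g.1 h.1)
    (gh2 : independent_rank_one g.2 h.2)
    (G_regular : regular_growth G o) :
  forall theta : R, theta \in `]0, pi / 2[ -> (0 < growth_rate G o theta)%E.
Proof.
move=> theta; rewrite in_itv/= => /andP[th0 th1].
have [U1 [k1 [N1 pp1]]] := ping_pong_exists o.1 hX1.1 hX1.2 gh1.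
have [U2 [k2 [N2 pp2]]] := ping_pong_exists o.2 hX2.1 hX2.2 gh2.
have {}pp1 := ping_pong_le (leq_maxl N1 N2) pp1.
have {}pp2 := ping_pong_le (leq_maxr N1 N2) pp2.
have [kap generic] := generic_product pp1 pp2.
have [C C0 wordC] := word_disp o g h (maxn N1 N2).
have pi20 : 0 < pi / 2 :> R by rewrite divr_gt0// pi_gt0.
have thI : theta \in `]- (pi / 2), pi / 2[.
  by rewrite in_itv/= th1 andbT (lt_trans _ th0)// oppr_lt0.
have T0 : 0 < tan theta.
  by rewrite -(tan0 R) ltr_tan// in_itv/= pi20 oppr_lt0 pi20.
have := @growth_rate_ge R X1 X2 o G _ _ kap C _ (lam_in gG hG _) generic
  (word_in gG hG _) (word_inj pp1) C0 wordC theta (tan theta) T0 (tanK thI).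
have r0 : (0 <= growth_rate G o 0)%E.
  by apply: G_regular; rewrite in_itv/= lexx ltW.
have r1 : (0 <= growth_rate G o (pi / 2))%E.
  by apply: G_regular; rewrite in_itv/= lexx ltW.
move=> /(_ r0 r1); apply: lt_le_trans.
have K0 : 0 < C + C / tan theta + 1.
  by rewrite ltr_wpDl// addr_ge0// divr_ge0// ltW.
have c0 : 0 < (tan theta + 2) * (C + C / tan theta + 1).
  by rewrite mulr_gt0// addr_gt0.
by rewrite lte_fin divr_gt0 ?ln_gt0 ?ltr1n// mulr_gt0// addr_gt0.
Qed.
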